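(* Let $\mathcal H$ be a complex Hilbert space, let $n,m,k\in\mathbb N$ with $n,m,k\ge 1$, and let $A_i,B_i,X_i\in B(\mathcal H)$ for $i=1,\dots,n$. Let $p,q>1$ with $\frac1p+\frac1q=1$, and let $\psi,\phi$ be non-negative continuous functions on $[0,\infty)$ such that $\psi(t)\phi(t)=t$ for all $t\in[0,\infty)$. Then for all real $r\ge 1$, $$w^{2k}\Big(\sum_{i=1}^{n}X_iA_i^mB_i\Big)\le \frac{n^{2k-1}}{m}\sum_{j=1}^{m}\sum_{i=1}^{n}\Big\|\frac1p S_{i,j}^{pr}+\frac1q T_{i,j}^{qr}\Big\|^{\frac kr}-r_0^k\inf_{\|\xi\|=1}\omega(\xi),$$ where $r_0=\min\{\frac1p,\frac1q\}$, $S_{i,j}=X_i\,\psi^2\big(|(A_i^{j})^*|\big)X_i^*$, $T_{i,j}=(A_i^{m-j}B_i)^*\,\phi^2\big(|A_i^j|\big)A_i^{m-j}B_i$ and $$\omega(\xi)=\frac{n^{2k-1}}{m}\sum_{j=1}^{m}\sum_{i=1}^{n}\Big(\langle S_{i,j}^{p}\xi,\xi\rangle^{\frac k2}-\langle T_{i,j}^{q}\xi,\xi\rangle^{\frac k2}\Big)^2 .$$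
   Context: $B(\mathcal H)$ is the $C^*$-algebra of bounded linear operators on $\mathcal H$ and $\|\cdot\|$ is the usual operator norm. For $T\in B(\mathcal H)$, $w(T)=\sup\{|\langle T\xi,\xi\rangle|:\xi\in\mathcal H,\ \|\xi\|=1\}$ is the numerical radius, $w^s(T)=(w(T))^s$, and $|T|=(T^*T)^{1/2}$. Functions and real powers of positive operators are taken in the sense of continuous functional calculus, $\psi^2(t)=(\psi(t))^2$, and $T^0=I$. *)

(* Defs.v *)
From HB Require Import structures.
From mathcomp Require Import all_boot all_order all_algebra.
From mathcomp Require Import complex.
From mathcomp Require Import all_classical all_reals all_analysis.

Set Implicit Arguments.
Unset Strict Implicit.
Unset Printing Implicit Defensive.

Import Order.TTheory GRing.Theory Num.Theory.
Import numFieldNormedType.Exports.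

Local Open Scope classical_set_scope.
Local Open Scope complex_scope.
Local Open Scope ring_scope.

(* [inner] is linear in its first and conjugate-linear in its second argument.
   The zero space is allowed; its unit sphere is empty, and [sup] and [inf] of
   the empty set are 0. *)
HB.mixin Record CompleteNormedModule_isHilbert (R : realType) H
    of CompleteNormedModule R[i] H := {
  inner : {dot H for (@Num.conj R[i])} ;
  sqr_norm_inner : forall x : H, `|x| ^+ 2 = inner x x
}.

#[short(type="hilbertType")]
HB.structure Definition Hilbert (R : realType) :=
  {H of CompleteNormedModule_isHilbert R H & CompleteNormedModule R[i] H}.

Notation "'[< x , y >]" := (inner x y)
  (at level 0, format "''[<' x ,  y '>]'") : ring_scope.

Section BoundedOperators.
Context {R : realType} {H : hilbertType R}.
Implicit Types f g : H -> H.

Definition bounded_linear : {pred (H -> H)} := fun f =>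
  `[< linear f /\ exists M : R, forall x, `|f x| <= M%:C * `|x| >].

Lemma bounded_linearP f :
  reflect (linear f /\ exists M : R, forall x, `|f x| <= M%:C * `|x|)
          (f \in bounded_linear).
Proof. exact: asboolP. Qed.

Lemma bounded_linear_submod : submod_closed bounded_linear.
Proof.
split=> [|a f g /bounded_linearP[fl [M fM]] /bounded_linearP[gl [N gN]]].
  apply/bounded_linearP; split=> [b x y|]; first by rewrite scaler0 addr0.
  by exists 0 => x; rewrite normr0 mul0r.
apply/bounded_linearP; split=> [b x y|].
  rewrite !fctE fl gl !scalerDr !scalerA (mulrC a b) !addrA; congr (_ + _).
  by rewrite -!addrA; congr (_ + _); rewrite addrC.
exists (complex.Re `|a| * M + N) => x; rewrite !fctE.
have -> : (complex.Re `|a| * M + N)%:C = `|a| * M%:C + N%:C :> R[i].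
  rewrite -[X in _ = X * _ + _]RRe_real ?normr_real//.
  by rewrite -!rmorphM -rmorphD.
rewrite mulrDl (le_trans (ler_normD _ _))// lerD// normrZ -mulrA.
by rewrite ler_wpM2l.
Qed.

HB.instance Definition _ := GRing.isSubmodClosed.Build R[i] (H -> H)
  bounded_linear bounded_linear_submod.

Lemma bounded_linear_id : (fun x : H => x) \in bounded_linear.
Proof.
by apply/bounded_linearP; split=> //; exists 1 => x; rewrite mul1r.
Qed.

Lemma bounded_linear_comp f g : f \in bounded_linear ->
  g \in bounded_linear -> f \o g \in bounded_linear.
Proof.
move=> /bounded_linearP[fl [M fM]] /bounded_linearP[gl [N gN]].
apply/bounded_linearP; split=> [b x y|]; first by rewrite /= gl fl.
exists (`|M| * N) => x /=; apply: (le_trans (fM _)).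
apply: (@le_trans _ _ (`|M|%:C * `|g x|)).
  by rewrite ler_wpM2r// lecR ler_norm.
rewrite rmorphM /= -mulrA ler_wpM2l// lecR; exact: normr_ge0.
Qed.

End BoundedOperators.

Section BoundedOperatorType.
Context {R : realType} (H : hilbertType R).

Record bop := Bop {
  bop_fun :> H -> H ;
  bop_bounded : bop_fun \in bounded_linear
}.

HB.instance Definition _ := [isSub for bop_fun].
HB.instance Definition _ := [Choice of bop by <:].
HB.instance Definition _ := [SubChoice_isSubLmodule of bop by <:].

Implicit Types S T U : bop.

Lemma bopP S T : S =1 T -> S = T.
Proof. by move=> ST; apply/val_inj/funext. Qed.

Definition bop_id : bop := Bop bounded_linear_id.
Definition bop_comp S T : bop :=
  Bop (bounded_linear_comp (bop_bounded S) (bop_bounded T)).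

Lemma bop_compA : associative bop_comp.
Proof. by move=> S T U; exact: bopP. Qed.

Lemma bop_comp1l : left_id bop_id bop_comp.
Proof. by move=> T; exact: bopP. Qed.

Lemma bop_comp1r : right_id bop_id bop_comp.
Proof. by move=> T; exact: bopP. Qed.

Lemma bop_compDl : left_distributive bop_comp +%R.
Proof. by move=> S T U; exact: bopP. Qed.

Lemma bop_linear T : linear T.
Proof. by have /bounded_linearP[] := bop_bounded T. Qed.

Lemma bop_compDr : right_distributive bop_comp +%R.
Proof.
move=> S T U; apply: bopP => x.
by have := bop_linear S 1 (T x) (U x); rewrite !scale1r.
Qed.

HB.instance Definition _ := GRing.Zmodule_isPzRing.Build bop
  bop_compA bop_comp1l bop_comp1r bop_compDl bop_compDr.

End BoundedOperatorType.

Section OperatorTheory.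
Context {R : realType} {H : hilbertType R}.
Implicit Types S T : bop H.

(* Norms of vectors and moduli of scalars are elements of R[i] lying on the
   real axis; [complex.Re] reads them back in R. *)
Definition opnorm T : R :=
  sup [set complex.Re `|T x| | x in [set x : H | `|x| <= 1]].

Definition numradius T : R :=
  sup [set complex.Re `|'[< T x, x >]| | x in [set x : H | `|x| = 1]].

Definition is_adjoint T S : Prop := forall x y : H, '[< T x, y >] = '[< x, S y >].

Definition adjoint T : bop H := xget (0 : bop H) [set S : bop H | is_adjoint T S].

Definition spectrum T : set R[i] :=
  [set z | let Tz := T - z *: (1 : bop H) in
           ~ exists S : bop H, S * Tz = 1 /\ Tz * S = 1].

Definition poly_op (p : {poly R}) T : bop H :=
  \sum_(i < size p) (p`_i)%:C *: T ^+ i.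

(* Continuous functional calculus for a self-adjoint T and a real function f
   continuous on the spectrum of T (which is then a compact subset of R): f(T)
   is the limit in operator norm of p(T) as the real polynomials p converge to
   f uniformly on the spectrum. Where no such limit exists, [fcalc] is 0. *)
Definition is_fcalc (f : R -> R) T (F : bop H) : Prop :=
  forall e : R, 0 < e -> exists2 d : R, 0 < d & forall p : {poly R},
    (forall t : R, spectrum T t%:C -> `|p.[t] - f t| < d) ->
    opnorm (poly_op p T - F) < e.

Definition fcalc (f : R -> R) T : bop H := xget (0 : bop H) [set F : bop H | is_fcalc f T F].

Definition absop T : bop H := fcalc Num.sqrt (adjoint T * T).

Definition powop T (s : R) : bop H := fcalc (fun t => t `^ s) T.

End OperatorTheory.

(* Main.v *)
Require Import Defs.
From HB Require Import structures.
From mathcomp Require Import all_boot all_order all_algebra.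
From mathcomp Require Import complex.
From mathcomp Require Import all_classical all_reals all_analysis.
From mathcomp Require Import ring lra.

(** At a unit vector x, put z_i = <X_i A_i^m B_i x, x>. The numerical radius to the
   power 2k is the supremum of |z_1 + ... + z_n|^(2k), and convexity of t^(2k)
   bounds this by n^(2k-1) times the sum of the |z_i|^(2k) ([exprn_sum_le]). Each
   j in 1..m gives a factorisation A_i^m = A_i^j A_i^(m-j), and for it the mixed
   Schwarz inequality ([mixed_schwarz]) reads |z_i|^2 <= <S_ij x, x> <T_ij x, x>. A
   refined form of Young's inequality, due to Kittaneh and Manasrah, together
   with the Holder-McCarthy inequality turns the k-th power of the right-hand
   side into the (i, j) terms of the statement ([schwarz_refined_young]).
   Averaging over j and bounding omega(x) below by its infimum finishes.

   The operator inequalities rest on the functional calculus of a positive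
   operator. Its existence needs that p(T) is bounded by the values of p on the
   real spectrum ([opnorm_poly_spectrum], through approximate eigenvectors and a
   factorisation over the complex numbers), that the real spectrum lies in
   [0, |T|] (a coercive symmetric operator is invertible, [lax_milgram]) and that
   polynomials are dense on segments ([weierstrass], by Bernstein polynomials).
   Products, linear combinations, positivity and commutation then pass to the
   limit from polynomials. The Holder-McCarthy inequality is the calculus applied
   to a tangent line ([fcalc_jensen]). The mixed Schwarz inequality avoids the
   polar decomposition: the contraction A (|A| + e)^-1 replaces its partial
   isometry. *)

Set Implicit Arguments.
Unset Strict Implicit.
Unset Printing Implicit Defensive.

Import Order.TTheory GRing.Theory Num.Theory.
Import numFieldNormedType.Exports.

Local Open Scope classical_set_scope.
Local Open Scope complex_scope.
Local Open Scope ring_scope.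

Lemma conjcE (R : rcfType) (c : R[i]) : Num.conj c = conjc c.
Proof. by []. Qed.

(** * The underlying real inner product *)

Section RealDot.
Context {R : realType} {H : hilbertType R}.
Implicit Types (x y z : H) (a : R) (c : R[i]).

(** Operators are real-linear for it, and being symmetric for it is the same as
   being self-adjoint, so that positivity, Cauchy-Schwarz and minimisation can
   be argued over [R] instead of over the partially ordered [R[i]]. *)
Definition rdot x y : R := complex.Re '[< x, y >].

Definition vnorm x : R := complex.Re `|x|.

Lemma Re_add c d : complex.Re (c + d) = complex.Re c + complex.Re d.
Proof. by case: c; case: d. Qed.

Lemma Re_opp c : complex.Re (- c) = - complex.Re c.
Proof. by case: c. Qed.

Lemma Re_scale a c : complex.Re (a%:C * c) = a * complex.Re c.
Proof. by case: c => u v /=; rewrite mul0r subr0. Qed.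

Lemma Re_conj c : complex.Re (Num.conj c) = complex.Re c.
Proof. by rewrite conjcE; case: c. Qed.

Lemma vnormE x : `|x| = (vnorm x)%:C.
Proof. by rewrite /vnorm RRe_real// normr_real. Qed.

Lemma vnorm_ge0 x : 0 <= vnorm x.
Proof. by rewrite -ler0c -vnormE. Qed.

Lemma dotxxE x : '[< x, x >] = (vnorm x ^+ 2)%:C.
Proof. by rewrite -sqr_norm_inner vnormE -rmorphXn. Qed.

Lemma rdotxx x : rdot x x = vnorm x ^+ 2.
Proof. by rewrite /rdot dotxxE. Qed.

Lemma rdotC x y : rdot x y = rdot y x.
Proof. by rewrite /rdot hermC expr0 mul1r Re_conj. Qed.

Lemma rdotDl x y z : rdot (x + y) z = rdot x z + rdot y z.
Proof. by rewrite /rdot linearDl Re_add. Qed.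

Lemma rdotDr x y z : rdot x (y + z) = rdot x y + rdot x z.
Proof. by rewrite !(rdotC x) rdotDl. Qed.

Lemma rdotZl a x y : rdot (a%:C *: x) y = a * rdot x y.
Proof. by rewrite /rdot linearZl_LR Re_scale. Qed.

Lemma rdotZr a x y : rdot x (a%:C *: y) = a * rdot x y.
Proof. by rewrite !(rdotC x) rdotZl. Qed.

Lemma rdotNl x y : rdot (- x) y = - rdot x y.
Proof. by rewrite /rdot linearNl Re_opp. Qed.

Lemma rdotNr x y : rdot x (- y) = - rdot x y.
Proof. by rewrite !(rdotC x) rdotNl. Qed.

Lemma rdot0l x : rdot 0 x = 0.
Proof. by rewrite /rdot linear0l. Qed.

Lemma rdot0r x : rdot x 0 = 0.
Proof. by rewrite rdotC rdot0l. Qed.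

Definition rdotE := (rdotDl, rdotDr, rdotNl, rdotNr, rdotZl, rdotZr).

(** The imaginary part is recovered from [rdot] because the inner product is
   conjugate-linear on the right; identities between real inner products thus
   lift to the complex one. *)
Lemma dotE x y : '[< x, y >] = rdot x y +i* rdot x ('i%C *: y).
Proof.
rewrite /rdot linearZr_LR/=; apply/eqP; rewrite eq_complex /= eqxx/=.
by rewrite conjcE; case: ('[< x, y >]) => u v /=; rewrite mul0r sub0r mulN1r opprK.
Qed.

Lemma dotIZ x y : '[< 'i%C *: x, 'i%C *: y >] = '[< x, y >].
Proof.
rewrite linearZl_LR linearZr_LR/= mulrA conjcE.
by case: ('[< x, y >]) => u v; simpc.
Qed.

Lemma vnorm0 : vnorm (0 : H) = 0.
Proof. by rewrite /vnorm normr0. Qed.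

Lemma vnorm_eq0 x : vnorm x = 0 -> x = 0.
Proof. by move=> x0; apply/eqP; rewrite -normr_eq0 vnormE x0. Qed.

Lemma vnormD x y : vnorm (x + y) <= vnorm x + vnorm y.
Proof. by rewrite -lecR rmorphD /= -!vnormE ler_normD. Qed.

Lemma vnormN x : vnorm (- x) = vnorm x.
Proof. by rewrite /vnorm normrN. Qed.

Lemma vnormB x y : vnorm (x - y) = vnorm (y - x).
Proof. by rewrite -vnormN opprB. Qed.

Lemma vnormZ c x : vnorm (c *: x) = complex.Re `|c| * vnorm x.
Proof. by apply: complexI; rewrite -vnormE normrZ rmorphM /= RRe_real ?normr_real// vnormE. Qed.

Lemma vnormZr a x : vnorm (a%:C *: x) = `|a| * vnorm x.
Proof. by rewrite vnormZ normc_def /= expr0n/= addr0 sqrtr_sqr. Qed.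

Lemma rdot_CS x y : `|rdot x y| <= vnorm x * vnorm y.
Proof.
have [y0|y0] := eqVneq (vnorm y) 0.
  by rewrite (vnorm_eq0 y0) rdot0r normr0 mulr_ge0 ?vnorm_ge0.
have yp : 0 < vnorm y by rewrite lt_neqAle eq_sym y0 vnorm_ge0.
rewrite -ler_sqr ?nnegrE ?mulr_ge0 ?vnorm_ge0// real_normK ?num_real//.
rewrite exprMn -!rdotxx.
have y2 : 0 < rdot y y by rewrite rdotxx exprn_gt0.
have : 0 <= rdot (x + (- (rdot x y / rdot y y))%:C *: y)
                 (x + (- (rdot x y / rdot y y))%:C *: y).
  by rewrite rdotxx sqr_ge0.
rewrite !rdotE (rdotC y x) => h.
have : 0 <= rdot y y * (rdot x x + - (rdot x y / rdot y y) * rdot x y +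
  (- (rdot x y / rdot y y) * (rdot x y) +
     - (rdot x y / rdot y y) * (- (rdot x y / rdot y y) * rdot y y))).
  apply: mulr_ge0; [exact: ltW|move: h; lra].
have -> : rdot y y * (rdot x x + - (rdot x y / rdot y y) * rdot x y +
  (- (rdot x y / rdot y y) * (rdot x y) +
     - (rdot x y / rdot y y) * (- (rdot x y / rdot y y) * rdot y y)))
  = rdot x x * rdot y y - rdot x y ^+ 2.
  by field; rewrite gt_eqF.
by rewrite subr_ge0.
Qed.

Lemma rdot_leCS x y : rdot x y <= vnorm x * vnorm y.
Proof. exact: le_trans (ler_norm _) (rdot_CS x y). Qed.

Lemma rdot_eq0 x : (forall y, rdot x y = 0) -> x = 0.
Proof.
by move=> /(_ x); rewrite rdotxx => /eqP; rewrite sqrf_eq0 => /eqP/vnorm_eq0.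
Qed.

(** Completeness with real radii: the uniform structure of [H] measures
   distances by elements of [R[i]]. *)
Lemma vcauchy_cvg (u : nat -> H) :
  (forall e : R, 0 < e -> exists N, forall n m, (N <= n)%N -> (N <= m)%N ->
     vnorm (u n - u m) <= e) ->
  exists l, forall e : R, 0 < e -> exists N, forall n, (N <= n)%N ->
     vnorm (u n - l) <= e.
Proof.
move=> uC.
have /cauchy_cvg/cvg_ex[/= l ul] : cauchy (u @ \oo).
  apply/cauchy_ballP => e e0; near_simpl.
  have e0' : 0 < complex.Re e by move: e0; rewrite ltcE => /andP[].
  have eE : e = (complex.Re e)%:C by rewrite RRe_real// gtr0_real.
  have [N NP] := uC _ (divr_gt0 e0' (ltr0n R 2)).
  exists ([set n | (N <= n)%N], [set n | (N <= n)%N]).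
    by split; exists N.
  move=> [n m] /= [Nn Nm]; rewrite -ball_normE /ball_/=.
  rewrite vnormE eE ltcR.
  apply: le_lt_trans (NP _ _ Nn Nm) _; lra.
exists l => e e0.
have e0' : 0 < e%:C by rewrite ltcR.
have [N _ NP] := (cvgrPdist_le _ _).1 ul _ e0'.
exists N => n Nn.
by have := NP n Nn; rewrite /= vnormE lecR vnormB.
Qed.
End RealDot.

Lemma invS_small (R : realType) (e : R) : 0 < e ->
  exists N, forall n, (N <= n)%N -> n.+1%:R^-1 <= e.
Proof.
move=> e0; exists (Num.truncn e^-1) => n Nn.
rewrite -[leRHS]invrK lef_pV2 ?posrE ?invr_gt0//.
apply: ltW; apply: lt_le_trans (_ : (Num.truncn e^-1).+1%:R <= _).
  by rewrite truncnS_gt.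
by rewrite ler_nat ltnS.
Qed.

(** * Operator norm and coercive forms *)

Section Operators.
Context {R : realType} {H : hilbertType R}.
Implicit Types (x y z : H) (a : R) (c : R[i]) (S T U : bop H).

Lemma bopDE S T x : (S + T) x = S x + T x. Proof. by []. Qed.
Lemma bopNE T x : (- T) x = - T x. Proof. by []. Qed.
Lemma bopZE c T x : (c *: T) x = c *: T x. Proof. by []. Qed.
Lemma bopME S T x : (S * T) x = S (T x). Proof. by []. Qed.
Lemma bop1E x : (1 : bop H) x = x. Proof. by []. Qed.
Lemma bop0E x : (0 : bop H) x = 0. Proof. by []. Qed.
Definition bopE := (bopDE, bopNE, bopZE, bopME, bop1E, bop0E).

Lemma bop_sumE (I : Type) (s : seq I) (P : pred I) (F : I -> bop H) x :
  (\sum_(i <- s | P i) F i) x = \sum_(i <- s | P i) F i x.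
Proof. by elim/big_rec2: _ => // i y S _ <-. Qed.

Lemma bop_add T x y : T (x + y) = T x + T y.
Proof. by have := bop_linear T 1 x y; rewrite !scale1r. Qed.

Lemma bop0 T : T 0 = 0.
Proof. by apply: (addrI (T 0)); rewrite -bop_add !addr0. Qed.

Lemma bop_scale T c x : T (c *: x) = c *: T x.
Proof. by have := bop_linear T c x 0; rewrite !addr0 bop0 addr0. Qed.

Lemma bop_opp T x : T (- x) = - T x.
Proof. by rewrite -scaleN1r bop_scale scaleN1r. Qed.

Lemma bop_sub T x y : T (x - y) = T x - T y.
Proof. by rewrite bop_add bop_opp. Qed.

Lemma bop_scaleMl c S T : (c *: S) * T = c *: (S * T).
Proof. exact: bopP. Qed.

Lemma bop_scaleMr c S T : S * (c *: T) = c *: (S * T).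
Proof. by apply: bopP => x; rewrite !bopE bop_scale. Qed.

(** Adjoints, inverses and limits of operators are first found vector by vector
   by choice; this turns the resulting function into an operator. *)
Lemma bop_of_fun (f : H -> H) : linear f -> (exists M : R, forall x, vnorm (f x) <= M * vnorm x) ->
  {T : bop H | forall x, T x = f x}.
Proof.
move=> fl fM.
have fb : f \in bounded_linear.
  apply/bounded_linearP; split=> //; case: fM => M fM; exists M => x.
  by rewrite !vnormE -rmorphM /= lecR.
by exists (Bop fb).
Qed.

Lemma opnorm_has_sup T :
  has_sup [set complex.Re `|T x| | x in [set x : H | `|x| <= 1]].
Proof.
split; first by exists (complex.Re `|T 0|), 0 => //=; rewrite normr0.
have /bounded_linearP[_ [M MT]] := bop_bounded T.
exists `|M| => _ [x /= x1 <-].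
have := MT x; rewrite !vnormE -rmorphM /= lecR => h.
apply: le_trans h _; move: x1; rewrite vnormE lecR => x1.
apply: (@le_trans _ _ (`|M| * vnorm x)).
  by rewrite ler_wpM2r ?vnorm_ge0 ?ler_norm.
by rewrite -[leRHS]mulr1 ler_wpM2l.
Qed.

Lemma opnorm_ge0 T : 0 <= opnorm T.
Proof.
apply: le_trans (vnorm_ge0 (T 0)) _; apply: sup_upper_bound.
  exact: opnorm_has_sup.
by exists 0 => //=; rewrite normr0.
Qed.

Lemma opnormP T x : vnorm (T x) <= opnorm T * vnorm x.
Proof.
have [x0|x0] := eqVneq (vnorm x) 0.
  by rewrite (vnorm_eq0 x0) bop0 vnorm0 mulr0.
have xp : 0 < vnorm x by rewrite lt_neqAle eq_sym x0 vnorm_ge0.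
rewrite -ler_pdivrMr//.
apply: sup_upper_bound; first exact: opnorm_has_sup.
exists ((vnorm x)^-1%:C *: x); rewrite /=.
  by rewrite vnormE lecR vnormZr ger0_norm ?invr_ge0 ?vnorm_ge0// mulVf.
rewrite bop_scale -/(vnorm _) vnormZr ger0_norm ?invr_ge0 ?vnorm_ge0//.
exact: mulrC.
Qed.

Lemma opnorm_le T a : 0 <= a -> (forall x, vnorm (T x) <= a * vnorm x) ->
  opnorm T <= a.
Proof.
move=> a0 Ta; apply: sup_le_ub; first by have [] := opnorm_has_sup T.
move=> _ [x /= x1 <-]; apply: le_trans (Ta x) _.
move: x1; rewrite vnormE lecR => x1.
by rewrite -[leRHS]mulr1 ler_wpM2l.
Qed.

Lemma opnorm_eq0 T : opnorm T <= 0 -> T = 0.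
Proof.
move=> T0; apply: bopP => x; apply: vnorm_eq0; apply/eqP.
rewrite eq_le vnorm_ge0 andbT (le_trans (opnormP T x))//.
by rewrite mulr_le0_ge0 ?vnorm_ge0.
Qed.

Lemma opnorm0 : opnorm (0 : bop H) = 0.
Proof.
apply/eqP; rewrite eq_le opnorm_ge0 andbT opnorm_le// => x.
by rewrite bop0E vnorm0 mul0r.
Qed.

Lemma opnormD S T : opnorm (S + T) <= opnorm S + opnorm T.
Proof.
apply: opnorm_le; first by rewrite addr_ge0 ?opnorm_ge0.
move=> x; rewrite bopDE mulrDl (le_trans (vnormD _ _))// lerD ?opnormP//.
Qed.

Lemma opnormN T : opnorm (- T) = opnorm T.
Proof.
by congr (sup _); apply: eq_imagel => x _; rewrite bopNE normrN.
Qed.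

Lemma opnormM S T : opnorm (S * T) <= opnorm S * opnorm T.
Proof.
apply: opnorm_le; first by rewrite mulr_ge0 ?opnorm_ge0.
move=> x; rewrite bopME (le_trans (opnormP _ _))// -mulrA.
by rewrite ler_wpM2l ?opnorm_ge0 ?opnormP.
Qed.

Lemma opnormZ a T : opnorm (a%:C *: T) <= `|a| * opnorm T.
Proof.
apply: opnorm_le; first by rewrite mulr_ge0 ?opnorm_ge0.
move=> x; rewrite bopZE vnormZr -mulrA.
by rewrite ler_wpM2l ?opnormP.
Qed.

(** Identities between limits are proved with a single scale [e], letting all
   the approximation errors be multiples of it. *)
Lemma opnorm_small T : (exists K : R, forall e, 0 < e -> e <= 1 -> opnorm T <= K * e) ->
  T = 0.
Proof.
move=> [K KT]; apply: opnorm_eq0; rewrite leNgt; apply/negP => T0.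
have K0 : 0 < K by have := KT 1 ltr01 (lexx _); rewrite mulr1; exact: lt_le_trans.
have e0 : 0 < opnorm T / (K *+ 2) by rewrite divr_gt0// pmulrn_lgt0.
have := KT (Num.min 1 (opnorm T / (K *+ 2))).
rewrite lt_min ltr01 e0 ge_min lexx => /(_ isT isT) h.
have : opnorm T <= K * (opnorm T / (K *+ 2)).
  by apply: le_trans h _; rewrite ler_wpM2l ?(ltW K0)// ge_min lexx orbT.
have -> : K * (opnorm T / (K *+ 2)) = opnorm T / 2.
  by rewrite -mulr_natr; field; rewrite gt_eqF.
lra.
Qed.

(** A sequence that is Cauchy in operator norm is uniformly Cauchy on bounded
   sets, hence converges pointwise; linearity and the uniform estimates pass to
   the pointwise limit. *)
Lemma bop_complete (P : nat -> bop H) :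
  (forall e : R, 0 < e -> exists N, forall n m, (N <= n)%N -> (N <= m)%N ->
     opnorm (P n - P m) <= e) ->
  exists F : bop H, forall e : R, 0 < e -> exists N, forall n, (N <= n)%N ->
     opnorm (P n - F) <= e.
Proof.
move=> PC.
have Px x : exists l, forall e : R, 0 < e -> exists N, forall n, (N <= n)%N ->
     vnorm (P n x - l) <= e.
  apply: vcauchy_cvg => e e0.
  have xp : 0 < vnorm x + 1 by rewrite ltr_wpDl ?vnorm_ge0.
  have [N NP] := PC _ (divr_gt0 e0 xp).
  exists N => n m Nn Nm; have := opnormP (P n - P m) x; rewrite !bopE => h.
  apply: le_trans h _; apply: le_trans (_ : e / (vnorm x + 1) * vnorm x <= _).
    by rewrite ler_wpM2r ?vnorm_ge0 ?NP.
  by rewrite mulrAC ler_pdivrMr// ler_wpM2l ?ltW// ltrDl.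
have [f fP] := choice Px.
have small (v : H) : (forall e, 0 < e -> vnorm v <= e) -> v = 0.
  move=> ve; apply: vnorm_eq0; apply/eqP; rewrite eq_le vnorm_ge0 andbT.
  by apply/ler_addgt0Pr => e e0; rewrite add0r ve.
have flin : linear f.
  move=> c x y; apply/eqP; rewrite -subr_eq0; apply/eqP/small => e e0.
  set k := complex.Re `|c|.
  have k0 : 0 <= k by rewrite /k -ler0c RRe_real ?normr_real.
  have d0 : 0 < e / (k + 2) by rewrite divr_gt0// ltr_wpDl.
  have [N1 h1] := fP (c *: x + y) _ d0.
  have [N2 h2] := fP x _ d0.
  have [N3 h3] := fP y _ d0.
  pose n := maxn N1 (maxn N2 N3).
  have -> : f (c *: x + y) - (c *: f x + f y) =
     - (P n (c *: x + y) - f (c *: x + y)) + c *: (P n x - f x)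
       + (P n y - f y).
    rewrite bop_linear scalerBr opprB -[RHS]addrA.
    by rewrite [X in _ = _ + X]addrACA -opprD subrKA.
  apply: le_trans (vnormD _ _) _.
  apply: le_trans (lerD (vnormD _ _) (lexx _)) _.
  rewrite vnormN vnormZ -/k.
  have -> : e = e / (k + 2) + k * (e / (k + 2)) + e / (k + 2).
    by field; rewrite gt_eqF// ltr_wpDl.
  rewrite !lerD ?ler_wpM2l ?h1 ?h2 ?h3//.
  - by rewrite leq_maxl.
  - by rewrite /n maxnCA leq_maxl.
  - by rewrite /n maxnA leq_maxr.
have lim x e N : 0 <= e ->
    (forall n, (N <= n)%N -> vnorm (P n x - P N x) <= e) -> vnorm (P N x - f x) <= e.
  move=> e0 h; apply/ler_addgt0Pr => d d0.
  have [N' N'P] := fP x _ d0.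
  pose n := maxn N N'.
  have -> : P N x - f x = - (P n x - P N x) + (P n x - f x).
    by rewrite opprB subrKA.
  apply: le_trans (vnormD _ _) _.
  by rewrite vnormN lerD ?h ?N'P ?leq_maxl ?leq_maxr.
have key e : 0 < e -> exists N, forall n x, (N <= n)%N -> vnorm (P n x - f x) <= e * vnorm x.
  move=> e0; have [N NP] := PC _ e0; exists N => n x Nn.
  apply: lim => [|m nm]; first by rewrite mulr_ge0 ?vnorm_ge0 ?ltW.
  have := opnormP (P m - P n) x; rewrite !bopE => h; apply: le_trans h _.
  by rewrite ler_wpM2r ?vnorm_ge0// NP// (leq_trans Nn).
have [|F FE] := bop_of_fun flin.
  have [N NP] := key 1 ltr01; exists (opnorm (P N) + 1) => x.
  have -> : f x = P N x - (P N x - f x) by rewrite opprB addrCA subrr addr0.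
  rewrite mulrDl (le_trans (vnormD _ _))// vnormN lerD ?opnormP//.
  exact: NP.
exists F => e e0; have [N NP] := key e e0; exists N => n Nn.
by apply: opnorm_le => [|x]; [exact: ltW|rewrite !bopE FE NP].
Qed.

Definition symop T := forall x y, rdot (T x) y = rdot x (T y).

(** Minimise J(x) = <Tx, x> - 2 f(x). Coercivity bounds J from below and, through
   the parallelogram identity, makes minimising sequences Cauchy; the first
   order optimality condition at the limit is the equation for [u]. With T = 1
   this is the Riesz representation theorem, which yields adjoints; in general
   it solves T u = y, which yields inverses. *)
Lemma lax_milgram T (c : R) (f : H -> R) (M : R) :
  symop T -> 0 < c -> (forall x, c * vnorm x ^+ 2 <= rdot (T x) x) ->
  (forall x y, f (x + y) = f x + f y) -> (forall a x, f (a%:C *: x) = a * f x) ->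
  (forall x, `|f x| <= M * vnorm x) ->
  exists u, forall x, f x = rdot (T u) x.
Proof.
move=> Tsym c0 Tc fD fZ fM.
pose J x := rdot (T x) x - 2 * f x.
have JD u t x : J (u + t%:C *: x) =
    J u + 2 * t * (rdot (T u) x - f x) + t ^+ 2 * rdot (T x) x.
  rewrite /J bop_add bop_scale !rdotE fD fZ (rdotC (T x) u) -Tsym.
  by ring.
have fN x : f (- x) = - f x.
  have := fZ (-1) x; rewrite rmorphN /= scaleN1r => ->; lra.
have Jlb x : - (M ^+ 2 / c) <= J x.
  have h1 := Tc x; have h2 : f x <= M * vnorm x.
    exact: le_trans (ler_norm _) (fM x).
  have h3 : 0 <= (c * vnorm x - M) ^+ 2 / c by rewrite divr_ge0 ?sqr_ge0 ?ltW.
  have h4 : (c * vnorm x - M) ^+ 2 / c = c * vnorm x ^+ 2 - 2 * (M * vnorm x) + M ^+ 2 / c.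
    by field; rewrite gt_eqF.
  rewrite /J; lra.
have Jinf : has_inf (range J).
  split; first by exists (J 0), 0.
  by exists (- (M ^+ 2 / c)) => _ [x _ <-].
set m := inf (range J).
have mJ x : m <= J x by apply: inf_lbound; [case: Jinf|exists x].
have Ju n : exists u, J u <= m + n.+1%:R^-1.
  have [|_ [u _ <-] /ltW h] := @inf_adherent _ (range J) n.+1%:R^-1 _ Jinf.
    by rewrite invr_gt0 ltr0n.
  by exists u.
have [u uP] := choice Ju.
have uC x y d : J x <= m + d -> J y <= m + d -> c * vnorm (x - y) ^+ 2 <= 4 * d.
  move=> hx hy.
  have := mJ (x + 2^-1%:C *: (y - x)); rewrite JD => h.
  have hy' : J y = J x + 2 * 1 * (rdot (T x) (y - x) - f (y - x))
    + 1 ^+ 2 * rdot (T (y - x)) (y - x).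
    by rewrite -JD rmorph1 scale1r addrCA subrr addr0.
  have := Tc (y - x); rewrite vnormB => h'.
  move: h hy'; lra.
have [l lP] : exists l, forall e : R, 0 < e -> exists N, forall n, (N <= n)%N ->
     vnorm (u n - l) <= e.
  apply: vcauchy_cvg => e e0.
  have e'0 : 0 < c * e ^+ 2 / 4 by rewrite divr_gt0// mulr_gt0// exprn_gt0.
  have [N NP] := invS_small e'0; exists N => n k Nn Nk.
  have := uC (u n) (u k) (c * e ^+ 2 / 4).
  have J' i : (N <= i)%N -> J (u i) <= m + c * e ^+ 2 / 4.
    by move=> Ni; apply: le_trans (uP i) _; rewrite lerD2l NP.
  move=> /(_ (J' _ Nn) (J' _ Nk)).
  have -> : 4 * (c * e ^+ 2 / 4) = c * e ^+ 2 by field.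
  rewrite ler_pM2l//.
  by rewrite ler_sqr ?nnegrE ?vnorm_ge0 ?(ltW e0).
exists l => x; apply/eqP; rewrite -subr_eq0 -oppr_eq0 opprB -normr_eq0; apply/eqP.
have [x0|x0] := eqVneq (vnorm x) 0.
  rewrite (vnorm_eq0 x0) rdot0r; have := fZ 0 0.
  by rewrite scaler0 mul0r => ->; rewrite subrr normr0.
have xp : 0 < vnorm x by rewrite lt_neqAle eq_sym x0 vnorm_ge0.
set b := rdot (T x) x.
have b0 : 0 < b by apply: lt_le_trans (Tc x); rewrite mulr_gt0// exprn_gt0.
(* the step along x minimises t |-> J (u n + t x), a quadratic in t *)
have opt n : (rdot (T (u n)) x - f x) ^+ 2 <= b * n.+1%:R^-1.
  have := mJ (u n + (- (rdot (T (u n)) x - f x) / b)%:C *: x).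
  rewrite JD -/b => h; have h' := uP n.
  set r := rdot _ _ - f x in h *.
  have e1 : 2 * (- r / b) * r + (- r / b) ^+ 2 * b = - (r ^+ 2 / b).
    by field; rewrite gt_eqF.
  rewrite -ler_pdivrMl// mulrC -(lerD2l m) (le_trans _ h')// -lerBrDr.
  by move: h; rewrite -addrA e1.
apply/eqP; rewrite eq_le normr_ge0 andbT; apply/ler_addgt0Pr => e e0; rewrite add0r.
pose K := opnorm T * vnorm x.
have K0 : 0 <= K by rewrite mulr_ge0 ?opnorm_ge0 ?vnorm_ge0.
have K1 : 0 < K + 1 by rewrite ltr_wpDl.
have d0 : 0 < e / 2 / (K + 1) by rewrite !divr_gt0.
have [N1 h1] := lP _ d0.
have e'0 : 0 < (e / 2) ^+ 2 / b by rewrite divr_gt0// exprn_gt0// divr_gt0.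
have [N2 h2] := invS_small e'0.
pose n := maxn N1 N2.
have -> : rdot (T l) x - f x = (rdot (T (u n)) x - f x) - rdot (T (u n - l)) x.
  by rewrite bop_sub !rdotE; ring.
apply: le_trans (ler_normB _ _) _; rewrite [e]splitr lerD//.
- rewrite -ler_sqr ?nnegrE ?divr_ge0 ?(ltW e0)// real_normK ?num_real//.
  apply: le_trans (opt n) _; rewrite -ler_pdivlMl// mulrC h2// leq_maxr//.
- apply: le_trans (rdot_CS _ _) _.
  apply: le_trans (ler_wpM2r (vnorm_ge0 _) (opnormP _ _)) _.
  rewrite mulrAC -/K; apply: le_trans (ler_wpM2l K0 (h1 _ (leq_maxl _ _))) _.
  rewrite mulrA ler_pdivrMr// mulrC ler_wpM2l ?divr_ge0 ?(ltW e0)//.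
  by rewrite lerDl.
Qed.
End Operators.

(** * Adjoints and positive operators *)

Section Adjoints.
Context {R : realType} {H : hilbertType R}.
Implicit Types (x y z : H) (a : R) (S T U : bop H).

Lemma rdotZrc (c : R[i]) x y : rdot x (c *: y) = rdot (Num.conj c *: x) y.
Proof. by rewrite /rdot linearZr_LR linearZl_LR. Qed.

(** The real identity suffices, since [S] is complex-linear. *)
Lemma is_adjointP T S : (forall x y, rdot (T x) y = rdot x (S y)) -> is_adjoint T S.
Proof. by move=> TS x y; rewrite !dotE !TS bop_scale. Qed.

(** Riesz representation of x |-> Re <Tx, y> gives the value at [y]. *)
Lemma adjoint_exists T : exists S, is_adjoint T S.
Proof.
have hy y : exists u, forall x, rdot (T x) y = rdot u x.
  have sym1 : symop (1 : bop H) by [].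
  apply: (@lax_milgram _ _ _ 1 _ (opnorm T * vnorm y) sym1) => //.
  - by move=> x; rewrite bop1E rdotxx mul1r.
  - by move=> u v; rewrite bop_add rdotDl.
  - by move=> a u; rewrite bop_scale rdotZl.
  - move=> x; apply: le_trans (rdot_CS _ _) _; rewrite mulrAC.
    by rewrite ler_wpM2r ?vnorm_ge0 ?opnormP.
have [g gP] := choice hy.
have glin : linear g.
  move=> c u v; apply/eqP; rewrite -subr_eq0; apply/eqP/rdot_eq0 => x.
  rewrite !rdotE -gP (rdotC (c *: _)) rdotZrc (rdotC _ (g u)) -!gP.
  by rewrite bop_scale -rdotZrc rdotDr; ring.
have [|S SE] := bop_of_fun glin.
  exists (opnorm T) => y.
  have [g0|g0] := eqVneq (vnorm (g y)) 0.
    by rewrite g0 mulr_ge0 ?opnorm_ge0 ?vnorm_ge0.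
  have gp : 0 < vnorm (g y) by rewrite lt_neqAle eq_sym g0 vnorm_ge0.
  rewrite -(ler_pM2l gp) -expr2 -rdotxx -gP.
  apply: le_trans (rdot_leCS _ _) _; rewrite mulrA (mulrC _ (opnorm T)).
  by rewrite ler_wpM2r ?vnorm_ge0 ?opnormP.
by exists S; apply: is_adjointP => x y; rewrite SE gP rdotC.
Qed.

Lemma adjointP T : is_adjoint T (adjoint T).
Proof. by have [S TS] := adjoint_exists T; apply: (xgetPex 0); exists S. Qed.

Lemma rdot_adj T x y : rdot (T x) y = rdot x (adjoint T y).
Proof. by rewrite /rdot adjointP. Qed.

Lemma rdot_adjr T x y : rdot x (T y) = rdot (adjoint T x) y.
Proof. by rewrite rdotC rdot_adj rdotC. Qed.

Lemma adjoint_eq T S : (forall x y, rdot (T x) y = rdot x (S y)) -> adjoint T = S.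
Proof.
move=> TS; apply: bopP => y; apply/eqP; rewrite -subr_eq0; apply/eqP.
by apply: rdot_eq0 => x; rewrite !rdotE !(rdotC _ x) -rdot_adj TS subrr.
Qed.

Lemma adjointK T : adjoint (adjoint T) = T.
Proof. by apply: adjoint_eq => x y; rewrite -rdot_adjr. Qed.

Definition posop T := symop T /\ forall x, 0 <= rdot (T x) x.

Lemma posop_conj P T : posop P -> posop (adjoint T * P * T).
Proof.
move=> [Ps P0]; split=> x; first by move=> y; rewrite !bopE -rdot_adjr Ps rdot_adj.
by rewrite !bopE -rdot_adjr P0.
Qed.

Lemma posop1 : posop (1 : bop H).
Proof. by split=> // x; rewrite bop1E rdotxx sqr_ge0. Qed.

(** Coercivity gives injectivity and the bound 1/c for the inverse, and
   [lax_milgram] gives surjectivity. *)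
Lemma coercive_invertible T (c : R) : symop T -> 0 < c ->
  (forall x, c * vnorm x ^+ 2 <= rdot (T x) x) ->
  exists S, S * T = 1 /\ T * S = 1.
Proof.
move=> Ts c0 Tc.
have hy y : exists u, T u = y.
  have [|||u uP] := @lax_milgram _ _ T c (fun x => rdot y x) (vnorm y) Ts c0 Tc.
  - by move=> u v; rewrite rdotDr.
  - by move=> a u; rewrite rdotZr.
  - by move=> x; exact: rdot_CS.
  exists u; apply/eqP; rewrite -subr_eq0; apply/eqP/rdot_eq0 => x.
  by rewrite !rdotE uP subrr.
have Tinj x y : T x = T y -> x = y.
  move=> xy; apply/eqP; rewrite -subr_eq0; apply/eqP/vnorm_eq0/eqP.
  rewrite -sqrf_eq0 eq_le sqr_ge0 andbT -(pmulr_rle0 _ c0).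
  by apply: le_trans (Tc _) _; rewrite bop_sub xy subrr rdot0l.
have [g gP] := choice hy.
have glin : linear g by move=> b u v; apply: Tinj; rewrite bop_linear !gP.
have [|S SE] := bop_of_fun glin.
  exists c^-1 => y; rewrite mulrC ler_pdivlMr//.
  have [g0|g0] := eqVneq (vnorm (g y)) 0.
    by rewrite g0 mul0r vnorm_ge0.
  have gp : 0 < vnorm (g y) by rewrite lt_neqAle eq_sym g0 vnorm_ge0.
  rewrite -(ler_pM2r gp) mulrAC -expr2 mulrC; apply: le_trans (Tc _) _.
  by rewrite gP; exact: rdot_leCS.
exists S; split; apply: bopP => x; rewrite !bopE SE ?gP//.
by apply: Tinj; rewrite gP.
Qed.

(** For real t outside [0, |T|], one of T - t and t - T is coercive. *)
Lemma posop_spectrum T (t : R) : posop T -> spectrum T t%:C -> 0 <= t <= opnorm T.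
Proof.
move=> [Ts T0] Tt; apply/andP; split; rewrite leNgt; apply/negP => t0; apply: Tt.
- apply: (@coercive_invertible _ (- t)); first 2 last.
  + by move=> x; rewrite !bopE !rdotE rdotxx; have := T0 x; lra.
  + by move=> x y; rewrite !bopE !rdotE Ts.
  + by rewrite oppr_gt0.
- have [||x|S [ST TS]] := @coercive_invertible (t%:C *: (1 : bop H) - T) (t - opnorm T).
  + by move=> x y; rewrite !bopE !rdotE Ts.
  + by rewrite subr_gt0.
  + rewrite !bopE !rdotE rdotxx mulrBl lerB//; apply: le_trans (rdot_leCS _ _) _.
    by rewrite expr2 mulrA ler_wpM2r ?vnorm_ge0 ?opnormP.
  by exists (- S); rewrite mulNr mulrN -mulrN -mulNr !opprB.
Qed.
End Adjoints.

(** * Polynomials of a self-adjoint operator *)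

Section PolyOp.
Context {R : realType} {H : hilbertType R}.
Implicit Types (x y : H) (a : R) (S T U : bop H) (p q : {poly R}) (P Q : {poly R[i]}).

(** Complex coefficients allow real polynomials of an operator to be split into
   linear factors. *)
Definition cpoly_op P T : bop H := \sum_(i < size P) P`_i *: T ^+ i.

Lemma cpoly_op_widen n P T : (size P <= n)%N ->
  cpoly_op P T = \sum_(i < n) P`_i *: T ^+ i.
Proof.
move=> Pn; rewrite /cpoly_op (big_ord_widen _ (fun i => P`_i *: T ^+ i) Pn).
rewrite big_mkcond; apply: eq_bigr => i _; case: ltnP => // Pi.
by rewrite nth_default// scale0r.
Qed.

Lemma cpoly_opD P Q T : cpoly_op (P + Q) T = cpoly_op P T + cpoly_op Q T.
Proof.
pose n := maxn (size P) (size Q).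
rewrite !(@cpoly_op_widen n) ?leq_maxl ?leq_maxr ?size_polyD//.
by rewrite -big_split; apply: eq_bigr => i _; rewrite coefD scalerDl.
Qed.

Lemma cpoly_opZ c P T : cpoly_op (c *: P) T = c *: cpoly_op P T.
Proof.
rewrite !(@cpoly_op_widen (size P)) ?size_scale_leq// scaler_sumr.
by apply: eq_bigr => i _; rewrite coefZ scalerA.
Qed.

Lemma cpoly_op1 T : cpoly_op 1 T = 1.
Proof.
by rewrite /cpoly_op size_poly1 big_ord1 coef1 scale1r expr0.
Qed.

Lemma cpoly_opC c T : cpoly_op c%:P T = c *: (1 : bop H).
Proof. by rewrite -alg_polyC cpoly_opZ cpoly_op1. Qed.

Lemma cpoly_opMX P T : cpoly_op (P * 'X) T = cpoly_op P T * T.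
Proof.
rewrite (@cpoly_op_widen (size P).+1) ?size_polyMleq//; last first.
  by apply: leq_trans (size_polyMleq _ _) _; rewrite size_polyX addn2.
rewrite big_ord_recl coefMX eqxx scale0r add0r mulr_suml.
by apply: eq_bigr => i _; rewrite coefMX /= exprSr bop_scaleMl.
Qed.

Lemma cpoly_opM P Q T : cpoly_op (P * Q) T = cpoly_op P T * cpoly_op Q T.
Proof.
elim/poly_ind: Q => [|Q c IH].
  by rewrite mulr0 -[0]/(0%:P) cpoly_opC scale0r mulr0.
rewrite mulrDr mulrA !cpoly_opD !cpoly_opMX IH mulrDr mulrA; congr (_ + _).
by rewrite mulrC mul_polyC cpoly_opZ cpoly_opC bop_scaleMr mulr1.
Qed.

Lemma cpoly_opX T : cpoly_op 'X T = T.
Proof. by rewrite -['X]mul1r cpoly_opMX cpoly_op1 mul1r. Qed.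

Lemma poly_opE p T : poly_op p T = cpoly_op (map_poly (real_complex R) p) T.
Proof.
rewrite /poly_op /cpoly_op size_map_poly; apply: eq_bigr => i _.
by rewrite coef_map.
Qed.

Lemma poly_opD p q T : poly_op (p + q) T = poly_op p T + poly_op q T.
Proof. by rewrite !poly_opE rmorphD cpoly_opD. Qed.

Lemma poly_opZ a p T : poly_op (a *: p) T = a%:C *: poly_op p T.
Proof. by rewrite !poly_opE map_polyZ cpoly_opZ. Qed.

Lemma poly_opN p T : poly_op (- p) T = - poly_op p T.
Proof. by rewrite -scaleN1r poly_opZ rmorphN rmorph1 scaleN1r. Qed.

Lemma poly_opB p q T : poly_op (p - q) T = poly_op p T - poly_op q T.
Proof. by rewrite poly_opD poly_opN. Qed.

Lemma poly_opC a T : poly_op a%:P T = a%:C *: (1 : bop H).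
Proof. by rewrite poly_opE map_polyC cpoly_opC. Qed.

Lemma poly_opM p q T : poly_op (p * q) T = poly_op p T * poly_op q T.
Proof. by rewrite !poly_opE rmorphM cpoly_opM. Qed.

Lemma poly_opX T : poly_op 'X T = T.
Proof. by rewrite poly_opE map_polyX cpoly_opX. Qed.

Lemma poly_op_intertwine p (V S T : bop H) : V * S = T * V ->
  V * poly_op p S = poly_op p T * V.
Proof.
move=> VST; elim/poly_ind: p => [|p c IH].
  by rewrite -[0]/(0%:P) !poly_opC scale0r mulr0 mul0r.
rewrite !poly_opD !poly_opM !poly_opX !poly_opC mulrDr mulrDl mulrA IH -!mulrA VST.
by rewrite bop_scaleMl bop_scaleMr mul1r mulr1.
Qed.

Lemma symop_poly p T : symop T -> symop (poly_op p T).
Proof.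
move=> Ts; elim/poly_ind: p => [|p c IH] x y.
  by rewrite -[0]/(0%:P) poly_opC scale0r rdot0l rdot0r.
have -> : p * 'X + c%:P = 'X * p + c%:P by rewrite mulrC.
rewrite {1}mulrC !poly_opD !poly_opM !poly_opX !poly_opC !bopE !rdotE.
by rewrite IH Ts.
Qed.

(** The part of invertibility that approximate eigenvectors contradict; unlike
   invertibility it is easily checked for T - z with z not real. *)
Definition bounded_below (S : bop H) := exists2 c : R, 0 < c & forall x, c * vnorm x <= vnorm (S x).

Lemma bounded_belowM S T : bounded_below S -> bounded_below T -> bounded_below (S * T).
Proof.
move=> [c c0 Sc] [d d0 Td]; exists (c * d); first exact: mulr_gt0.
move=> x; rewrite bopME (le_trans _ (Sc _))// -mulrA.
by rewrite (ler_pM2l c0).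
Qed.

(** For z = a + ib the symmetry of [T] gives |(T - z)x|^2 = |(T - a)x|^2 + b^2 |x|^2. *)
Lemma bounded_below_nonreal T (z : R[i]) : symop T -> complex.Im z != 0 ->
  bounded_below (T - z *: (1 : bop H)).
Proof.
move=> Ts z0; exists `|complex.Im z|; first by rewrite normr_gt0.
move=> x; rewrite -ler_sqr ?nnegrE ?mulr_ge0 ?vnorm_ge0//.
rewrite exprMn real_normK ?num_real// -!rdotxx.
have Si (v w : H) : rdot ('i%C *: v) ('i%C *: w) = rdot v w by rewrite /rdot dotIZ.
have Ai (v : H) : rdot v ('i%C *: v) = 0.
  have := Si v ('i%C *: v); rewrite scalerA -expr2 sqr_i scaleN1r rdotNr rdotC; lra.
have -> : (T - z *: (1 : bop H)) x = T x - (complex.Re z)%:C *: x - (complex.Im z)%:C *: ('i%C *: x).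
  rewrite !bopE; rewrite {1}[z]complexE scalerDl opprD addrA.
  by rewrite [_ * (complex.Im z)%:C]mulrC -scalerA.
have ATi : rdot (T x) ('i%C *: x) = 0.
  have : rdot (T x) ('i%C *: x) = - rdot (T x) ('i%C *: x); last by lra.
  by rewrite {1}Ts bop_scale rdotC -(Si _ x) scalerA -expr2 sqr_i scaleN1r rdotNl.
rewrite !rdotE ![rdot ('i%C *: x) _]rdotC Si Ai ATi.
set u := complex.Re z; set v := complex.Im z.
have := sqr_ge0 (vnorm (T x - u%:C *: x)); rewrite -!rdotxx !rdotE.
rewrite [rdot x (T x)]rdotC; lra.
Qed.

Lemma bounded_below_nonspectral T (z : R[i]) : ~ spectrum T z -> bounded_below (T - z *: (1 : bop H)).
Proof.
move=> /contrapT[S [ST _]]; exists (opnorm S + 1)^-1.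
  by rewrite invr_gt0 ltr_wpDl ?opnorm_ge0.
move=> x; rewrite ler_pdivrMl ?ltr_wpDl ?opnorm_ge0//.
have {1}-> : x = S ((T - z *: (1 : bop H)) x) by rewrite -bopME ST.
rewrite mulrDl mul1r (le_trans (opnormP _ _))//.
by rewrite lerDl vnorm_ge0.
Qed.

(** Let S = p(T) and M its norm. Vectors at which |Sx| comes close to M|x| are
   almost annihilated by S^2 - M^2, so p^2 - M^2, evaluated at [T], is not
   bounded below. Factor this polynomial over the complex numbers: some root z
   has T - z not bounded below, hence z is real and belongs to the spectrum.
   Only a nonzero polynomial splits in this way. *)
Lemma spectral_value T p : symop T -> (exists x : H, x != 0) ->
  p ^+ 2 - (opnorm (poly_op p T) ^+ 2)%:P != 0 ->
  exists2 t, spectrum T t%:C & p.[t] ^+ 2 = opnorm (poly_op p T) ^+ 2.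
Proof.
move=> Ts [x0 x00]; set S := poly_op p T; set M := opnorm S.
set q := _ - _ => q0; apply: contrapT => noroot.
have Ss : symop S by apply: symop_poly.
have [c c0 qc] : bounded_below (poly_op q T).
  rewrite poly_opE.
  have rootq (z : R[i]) : root (map_poly (real_complex R) q) z -> bounded_below (T - z *: (1 : bop H)).
    move=> qz; have [z0|z0] := eqVneq (complex.Im z) 0; last exact: bounded_below_nonreal.
    have zE : z = (complex.Re z)%:C by rewrite {1}[z]complexE z0 mulr0 addr0.
    apply: bounded_below_nonspectral => zT; apply: noroot.
    exists (complex.Re z); first by rewrite -zE.
    move: qz; rewrite zE fmorph_root rootE /q !hornerE => /eqP; lra.
  have : map_poly (real_complex R) q != 0 by rewrite map_poly_eq0.
  move: (map_poly _ q) rootq => Q rootQ.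
  have [rs QE] := closed_field_poly_normal Q.
  rewrite -lead_coef_eq0; move: (lead_coef Q) QE rootQ => a -> rootQ a0.
  rewrite cpoly_opZ.
  have belowP : bounded_below (cpoly_op (\prod_(z <- rs) ('X - z%:P)) T).
    have {rootQ} : {in rs, forall z : R[i], bounded_below (T - z *: (1 : bop H))}.
      by move=> z zrs; apply: rootQ; rewrite rootZ// root_prod_XsubC.
    elim: rs => [|z rs IH] zrs.
      by rewrite big_nil cpoly_op1; exists 1 => // x; rewrite mul1r.
    rewrite big_cons cpoly_opM; apply: bounded_belowM; last first.
      by apply: IH => w wrs; apply: zrs; rewrite inE wrs orbT.
    by rewrite -polyCN cpoly_opD cpoly_opX cpoly_opC scaleNr; apply/zrs/mem_head.
  case: belowP => d d0 dP; have k0 : 0 < complex.Re `|a|.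
    by rewrite -ltcR RRe_real ?normr_real// normr_gt0.
  exists (complex.Re `|a| * d); first by rewrite mulr_gt0.
  by move=> x; rewrite bopZE vnormZ -mulrA ler_wpM2l// ltW.
have qS : poly_op q T = S * S - (M ^+ 2)%:C *: (1 : bop H).
  by rewrite poly_opB expr2 poly_opM poly_opC.
have M0 : 0 <= M by apply: opnorm_ge0.
have SM x : vnorm (S x) <= M * vnorm x by apply: opnormP.
(* expand the square; symmetry turns its cross term into |S x|^2 *)
have key x : M ^+ 2 * vnorm (S x) ^+ 2 <= (M ^+ 4 - c ^+ 2) * vnorm x ^+ 2.
  have h1 : c ^+ 2 * vnorm x ^+ 2 <= vnorm (poly_op q T x) ^+ 2.
    rewrite -exprMn ler_sqr ?nnegrE ?vnorm_ge0 ?mulr_ge0 ?vnorm_ge0 ?(ltW c0)//.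
  have h2 : vnorm (S (S x)) ^+ 2 <= M ^+ 2 * vnorm (S x) ^+ 2.
    by rewrite -exprMn ler_sqr ?nnegrE ?vnorm_ge0 ?mulr_ge0 ?vnorm_ge0.
  have h3 : rdot (S (S x)) x = vnorm (S x) ^+ 2 by rewrite Ss rdotxx.
  by move: h1; rewrite qS !bopE -[leRHS]rdotxx !rdotE (rdotC x) h3 !rdotxx; lra.
have xp : 0 < vnorm x0.
  by rewrite lt_neqAle vnorm_ge0 andbT eq_sym; apply: contra x00 => /eqP/vnorm_eq0 ->.
have c2 : 0 < c ^+ 2 by rewrite exprn_gt0.
have c4 : 0 <= M ^+ 4 - c ^+ 2.
  rewrite -(pmulr_lge0 _ (exprn_gt0 2 xp)); apply: le_trans (key x0).
  by rewrite mulr_ge0 ?sqr_ge0.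
have [M00|M00] := eqVneq M 0.
  by move: c4; rewrite M00 expr0n /=; lra.
have Mp : 0 < M by rewrite lt_neqAle eq_sym M00.
have : M <= Num.sqrt (M ^+ 2 - c ^+ 2 / M ^+ 2).
  apply: opnorm_le => [|x]; first exact: sqrtr_ge0.
  rewrite -ler_sqr ?nnegrE ?vnorm_ge0 ?mulr_ge0 ?sqrtr_ge0 ?vnorm_ge0//.
  have e1 : M ^+ 2 - c ^+ 2 / M ^+ 2 = (M ^+ 4 - c ^+ 2) / M ^+ 2 by field.
  rewrite exprMn e1 sqr_sqrtr ?divr_ge0 ?sqr_ge0// mulrAC ler_pdivlMr ?exprn_gt0//.
  by rewrite mulrC; exact: key.
apply/negP; rewrite -ltNge -[ltRHS](ger0_norm M0) -sqrtr_sqr ltr_sqrt ?exprn_gt0//.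
by rewrite ltrBlDr ltrDl divr_gt0 ?exprn_gt0.
Qed.

(** When p^2 is the constant M^2, [spectral_value] does not apply to [p], but it
   applies to the polynomial X and shows that the spectrum has a real point;
   evaluating [p] there gives the bound. *)
Lemma opnorm_poly_spectrum T p (c : R) : symop T -> 0 <= c ->
  (forall t, spectrum T t%:C -> `|p.[t]| <= c) -> opnorm (poly_op p T) <= c.
Proof.
move=> Ts c0 pc.
have [[x0 x00]|notriv] := pselect (exists x : H, x != 0); last first.
  apply: opnorm_le => // x; have -> : x = 0.
    by apply/eqP/negPn/negP => x0; apply: notriv; exists x.
  by rewrite bop0 vnorm0 mulr0.
have nontriv : exists x : H, x != 0 by exists x0.
have sq t : p.[t] ^+ 2 = opnorm (poly_op p T) ^+ 2 -> `|p.[t]| = opnorm (poly_op p T).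
  by move=> /(congr1 Num.sqrt); rewrite !sqrtr_sqr (ger0_norm (opnorm_ge0 _)).
have [q0|q0] := eqVneq (p ^+ 2 - (opnorm (poly_op p T) ^+ 2)%:P) 0.
  have X0 : 'X ^+ 2 - (opnorm (poly_op 'X T) ^+ 2)%:P != 0 :> {poly R}.
    by rewrite -size_poly_eq0 size_XnsubC.
  have [t Tt _] := spectral_value Ts nontriv X0.
  rewrite -(@sq t) ?pc//; move/(congr1 (fun q => q.[t])): q0.
  by rewrite !hornerE => /eqP; rewrite subr_eq0 => /eqP.
by have [t Tt /sq <-] := spectral_value Ts nontriv q0; exact: pc.
Qed.
End PolyOp.

(** * Polynomial approximation and scalar inequalities *)

Section Numeric.
Context {R : realType}.
Implicit Types (a b s t x y z : R) (f g : R -> R) (h : nat -> R).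

(** Continuity on the half-line t >= 0, expressed by composing with the
   retraction max(0, .) so that the rules for continuity on the whole line apply. *)
Definition nneg_cont f := continuous (fun t => f (Num.max 0 t)).

Lemma nneg_cont_within f : {within `[0, +oo[, continuous f} -> nneg_cont f.
Proof.
move=> fc t Q fQ.
have A0 u : `[0 : R, +oo[%classic (Num.max 0 u).
  by rewrite /= in_itv/= andbT le_max lexx.
have := fc (Num.max 0 t) Q fQ.
rewrite /nbhs/= -nbhs_subspace_in// => fQ'.
have h : \forall u \near t, `[0, +oo[%classic (Num.max 0 u) -> Q (f (Num.max 0 u)).
  exact: (@continuous_max R R (cst 0) id t (@cst_continuous _ _ _ _) (@cvg_id _ _) _ fQ').
by apply: filterS h => u /= Wu; apply: Wu; exact: A0.
Qed.

Lemma nneg_contM f g : nneg_cont f -> nneg_cont g -> nneg_cont (fun t => f t * g t).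
Proof. by move=> fc gc t; apply: cvgM; [exact: fc|exact: gc]. Qed.

Lemma nneg_contD f g : nneg_cont f -> nneg_cont g -> nneg_cont (fun t => f t + g t).
Proof. by move=> fc gc t; apply: cvgD; [exact: fc|exact: gc]. Qed.

Lemma nneg_cont_cst a : nneg_cont (fun=> a).
Proof. by move=> t; exact: cvg_cst. Qed.

Lemma nneg_cont_sqrt f : nneg_cont f -> nneg_cont (fun t => Num.sqrt (f t)).
Proof.
move=> fc t; apply: (@continuous_comp _ _ _ (fun t => f (Num.max 0 t)) Num.sqrt).
  exact: fc.
exact: sqrt_continuous.
Qed.

Lemma nneg_cont_id : nneg_cont id.
Proof.
move=> t.
exact: (@continuous_max R R (cst 0) id t (@cst_continuous _ _ _ _) (@cvg_id _ _)).
Qed.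

Lemma nneg_cont_inv f : (forall t, 0 <= t -> f t != 0) ->
  nneg_cont f -> nneg_cont (fun t => (f t)^-1).
Proof.
move=> f0 fc t; apply: cvgV; last exact: fc.
by apply: f0; rewrite le_max lexx.
Qed.

Lemma nneg_cont_poly (p : {poly R}) : nneg_cont (fun t => p.[t]).
Proof.
move=> t; apply: (@continuous_comp _ _ _ (fun t => Num.max 0 t) (horner p)).
  exact: nneg_cont_id.
exact: continuous_horner.
Qed.

(** At a zero of [f] the power is not differentiable in general, and the estimate
   t^s <= e for t <= e^(1/s) replaces the derivative. *)
Lemma nneg_cont_powR s f : 0 < s -> (forall t, 0 <= t -> 0 <= f t) ->
  nneg_cont f -> nneg_cont (fun t => f t `^ s).
Proof.
move=> s0 f0 fc t; set m := fun t => f (Num.max 0 t).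
have m0 u : 0 <= m u by apply: f0; rewrite le_max lexx.
have mc : m u @[u --> t] --> m t by exact: fc.
rewrite /continuous_at -/(m t).
have [t0|t0] := eqVneq (m t) 0; last first.
  have : derivable (fun x : R => x `^ s) (m t) 1.
    by apply: derivable_powR; rewrite in_itv/= andbT lt_neqAle eq_sym t0 m0.
  move=> /derivable1_diffP/differentiable_continuous pc.
  exact: (@continuous_comp _ _ _ m (fun x : R => x `^ s)).
rewrite t0 powR0 ?gt_eqF//; apply/cvgrPdist_le => e e0.
have e's : 0 < e `^ s^-1 by rewrite powR_gt0.
move/cvgrPdist_le : mc => /(_ _ e's); apply: filterS => u.
rewrite t0 !sub0r !normrN ger0_norm ?m0// ger0_norm ?powR_ge0// => mu.
rewrite -[leRHS]powRr1 ?(ltW e0)// -(mulVf (lt0r_neq0 s0)) powRrM.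
by rewrite ge0_ler_powR ?nnegrE ?m0 ?powR_ge0 ?(ltW s0).
Qed.

(** Uniform continuity in the form used by Bernstein's proof: the quadratic term
   dominates the oscillation at distant points, and its average is a variance. *)
Lemma continuous_modulus g d : continuous g -> 0 < d ->
  exists2 C, 0 <= C & forall x y, 0 <= x <= 1 -> 0 <= y <= 1 ->
    `|g x - g y| <= d + C * (x - y) ^+ 2.
Proof.
move=> gc d0.
have [e e0 eP] : exists2 e, 0 < e &
    forall x, 0 <= x <= 1 -> forall y, `|x - y| < e -> `|g x - g y| < d.
  have /compact_near_coveringP := @segment_compact R 0 1.
  move=> /(_ _ (0 : R)^'+ (fun e x => forall y, `|x - y| < e -> `|g x - g y| < d)).
  case.
    move=> x _; have d20 : 0 < d / 2 by rewrite divr_gt0.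
    have /cvgrPdist_lt/(_ _ d20)[r /= r0 rP] := gc x.
    have r20 : 0 < r / 2 by rewrite divr_gt0.
    exists (ball x (r / 2), [set e | e < r / 2]).
      by split; [exact: nbhsx_ballx|by rewrite /=; exact: nbhs_right_lt].
    move=> [x' e] /= [xx er] y x'y.
    have xx' : `|x - x'| < r / 2 by [].
    have h1 : `|g x - g x'| < d / 2.
      by apply: rP => /=; apply: lt_le_trans xx' _; lra.
    have h2 : `|g x - g y| < d / 2.
      apply: rP => /=; rewrite -(subrK x' x) -addrA.
      apply: le_lt_trans (ler_normD _ _) _.
      lra.
    rewrite -(subrK (g x) (g x')) -addrA.
    apply: le_lt_trans (ler_normD _ _) _; rewrite distrC; lra.
  move=> e /= e0 eP; exists (e / 2); first by rewrite divr_gt0.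
  move=> x x01; apply: (eP (e / 2)) => //=.
  - by rewrite /ball_/= sub0r normrN gtr0_norm ?divr_gt0//; lra.
  - by rewrite divr_gt0.
have [||K _ KP] := @EVT_max R (fun x => `|g x|) 0 1; first exact: ler01.
  apply: continuous_subspaceT => x; apply: continuous_comp; first exact: gc.
  exact: norm_continuous.
have KP' x : 0 <= x <= 1 -> `|g x| <= `|g K| by move=> x01; apply: KP.
have C0 : 0 <= 2 * `|g K| / e ^+ 2.
  by apply: divr_ge0; [exact: mulr_ge0|exact: sqr_ge0].
exists (2 * `|g K| / e ^+ 2) => //.
move=> x y x01 y01; have [xy|xy] := ltP `|x - y| e.
  apply: (@le_trans _ _ d); first exact/ltW/eP.
  by rewrite lerDl mulr_ge0 ?sqr_ge0.
apply: (@le_trans _ _ (2 * `|g K|)).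
  apply: le_trans (ler_normB _ _) _; have := KP' _ x01; have := KP' _ y01; lra.
have exy : e ^+ 2 <= (x - y) ^+ 2.
  by rewrite -[leRHS]real_normK ?num_real// ler_sqr ?nnegrE ?(ltW e0).
apply: (@le_trans _ _ (2 * `|g K| / e ^+ 2 * e ^+ 2)).
  by rewrite divfK// gt_eqF ?exprn_gt0.
by rewrite -[leLHS]add0r lerD ?(ltW d0)// ler_wpM2l.
Qed.

(** de Casteljau's recursion for the Bernstein polynomial of the values
   h j, ..., h (j + n). Monotonicity, linearity and the second moment follow from
   it by induction, without binomial coefficients. *)
Fixpoint bernstein n (h : nat -> R) j : {poly R} :=
  if n is m.+1 then 'X * bernstein m h j.+1 + (1 - 'X) * bernstein m h j
  else (h j)%:P.

Lemma bernsteinS n h j x :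
  (bernstein n.+1 h j).[x] = x * (bernstein n h j.+1).[x] + (1 - x) * (bernstein n h j).[x].
Proof. by rewrite /= !hornerE. Qed.

Lemma bernstein_le n (h h' : nat -> R) j x : 0 <= x <= 1 ->
  (forall i, (j <= i <= j + n)%N -> h i <= h' i) ->
  (bernstein n h j).[x] <= (bernstein n h' j).[x].
Proof.
move=> /andP[x0 x1]; elim: n j => [|n IH] j hh'.
  by rewrite !hornerC hh'// addn0 leqnn.
rewrite !bernsteinS lerD// ler_wpM2l ?subr_ge0// IH// => i /andP[ji ijn]; apply: hh'.
  by rewrite (ltnW ji) -addSnnS.
by rewrite ji addnS ltnW.
Qed.

Lemma bernsteinD n (h h' : nat -> R) j x :
  (bernstein n (fun i => h i + h' i) j).[x] = (bernstein n h j).[x] + (bernstein n h' j).[x].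
Proof.
elim: n j => [|n IH] j; first by rewrite !hornerC.
by rewrite !bernsteinS !IH; ring.
Qed.

Lemma bernsteinZ n c (h : nat -> R) j x :
  (bernstein n (fun i => c * h i) j).[x] = c * (bernstein n h j).[x].
Proof.
elim: n j => [|n IH] j; first by rewrite !hornerC.
by rewrite !bernsteinS !IH; ring.
Qed.

Lemma bernstein_cst n c j x : (bernstein n (fun=> c) j).[x] = c.
Proof.
elim: n j => [|n IH] j; first by rewrite !hornerC.
by rewrite !bernsteinS !IH; ring.
Qed.

(** Second moment about [c] of the binomial law shifted by [j]. *)
Lemma bernstein_var n c j x :
  (bernstein n (fun i => (i%:R - c) ^+ 2) j).[x]
    = n%:R * x * (1 - x) + (j%:R + n%:R * x - c) ^+ 2.
Proof.
elim: n j => [|n IH] j; first by rewrite hornerC; ring.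
by rewrite bernsteinS !IH -!natr1; ring.
Qed.

(** The Bernstein polynomial averages the values g(i/n) against a binomial law of
   mean n x, and [continuous_modulus] bounds the error by d/2 plus C times the
   variance of i/n, which is at most 1/n. *)
Lemma weierstrass01 g d : continuous g -> 0 < d ->
  exists p : {poly R}, forall x, 0 <= x <= 1 -> `|p.[x] - g x| < d.
Proof.
move=> gc d0; have d20 : 0 < d / 2 by rewrite divr_gt0.
have [C C0 CP] := continuous_modulus gc d20.
pose n := (Num.truncn (C / (d / 2))).+1.
have n0 : 0 < n%:R :> R by rewrite ltr0n.
have Cn : C / n%:R < d / 2.
  rewrite ltr_pdivrMr// mulrC -ltr_pdivrMr//; exact: truncnS_gt.
exists (bernstein n (fun i => g (i%:R / n%:R)) 0) => x x01.
set h := fun i : nat => d / 2 + C / n%:R ^+ 2 * (i%:R - n%:R * x) ^+ 2.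
have hP : (bernstein n h 0).[x] < d.
  rewrite /h bernsteinD bernstein_cst bernsteinZ bernstein_var.
  have -> : C / n%:R ^+ 2 * (n%:R * x * (1 - x) + (0%:R + n%:R * x - n%:R * x) ^+ 2)
    = C / n%:R * (x * (1 - x)) by field; rewrite gt_eqF.
  have : C / n%:R * (x * (1 - x)) <= C / n%:R * 1.
    apply: ler_wpM2l; first by rewrite divr_ge0// ltW.
    by have := sqr_ge0 x; case/andP: x01 => ? ?; lra.
  lra.
have hg i : (i <= n)%N -> `|g (i%:R / n%:R) - g x| <= h i.
  move=> iN; apply: le_trans (CP _ _ _ x01) _.
    rewrite divr_ge0 ?(ltW n0) ?ler0n// ler_pdivrMr// mul1r ler_nat//.
  rewrite lerD2l le_eqVlt; apply/orP; left; apply/eqP.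
  by field; rewrite gt_eqF.
apply: le_lt_trans hP; set u := fun i : nat => g _.
have hi : (bernstein n u 0).[x] <= (bernstein n (fun i => g x + h i) 0).[x].
  apply: bernstein_le => // i /andP[_ /hg]; rewrite -/(u i) ler_norml => /andP[_].
  by rewrite lerBlDl.
have lo : (bernstein n (fun i => g x + -1 * h i) 0).[x] <= (bernstein n u 0).[x].
  apply: bernstein_le => // i /andP[_ /hg]; rewrite -/(u i) ler_norml => /andP[+ _].
  by rewrite lerBrDl mulN1r.
have uE c : (bernstein n (fun i => g x + c * h i) 0).[x] = g x + c * (bernstein n h 0).[x].
  by rewrite (bernsteinD _ (fun=> g x)) bernstein_cst bernsteinZ.
rewrite ler_norml lerBrDl -mulN1r -uE lo lerBlDl.
by apply: le_trans hi _; rewrite (bernsteinD _ (fun=> g x)) bernstein_cst.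
Qed.

Lemma weierstrass f (N d : R) : nneg_cont f -> 0 < d ->
  exists p : {poly R}, forall t, 0 <= t <= N -> `|p.[t] - f t| < d.
Proof.
move=> fc d0; pose K := `|N| + 1.
have K0 : 0 < K by rewrite ltr_wpDl.
have gc : continuous (fun x => f (Num.max 0 (K * x))).
  move=> x; apply: (@continuous_comp _ _ _ (fun x => K * x) (fun t => f (Num.max 0 t))).
    by apply: cvgM; [exact: cvg_cst|exact: cvg_id].
  exact: fc.
have [p pP] := weierstrass01 gc d0.
exists (p \Po (K^-1 *: 'X)) => t /andP[t0 tN].
rewrite horner_comp !hornerE.
have := pP (K^-1 * t); rewrite mulVKf ?gt_eqF// max_r//; apply.
rewrite mulr_ge0 ?invr_ge0 ?(ltW K0)//= mulrC ler_pdivrMr// mul1r.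
by apply: le_trans tN _; rewrite /K; have := ler_norm N; lra.
Qed.

(** Young's inequality for the product t l^(r-1), multiplied by r. The Jensen
   inequalities below, for numbers and for operators, average this bound. *)
Lemma powR_tangent r t l : 1 <= r -> 0 <= t -> 0 <= l ->
  l `^ r + r * l `^ (r - 1) * (t - l) <= t `^ r.
Proof.
move=> r1 t0 l0; have [->|rN1] := eqVneq r 1.
  by rewrite subrr powRr0 !powRr1//; lra.
have r1' : 1 < r by rewrite lt_neqAle eq_sym rN1.
have rm0 : 0 < r - 1 by lra.
have r0 : 0 < r by lra.
have rr0 : 0 < r / (r - 1) by rewrite divr_gt0.
have := @conjugate_powR _ t (l `^ (r - 1)) r (r / (r - 1)) t0 (powR_ge0 _ _) r0 rr0.
have -> : r^-1 + (r / (r - 1))^-1 = 1 by field; rewrite !gt_eqF.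
have e1 : (r - 1) * (r / (r - 1)) = r by field; rewrite gt_eqF.
rewrite -powRrM e1 => /(_ erefl) h.
have e2 : l * l `^ (r - 1) = l `^ r by rewrite mulr_powRB1.
have : r * (t * l `^ (r - 1)) <= r * (t `^ r / r + l `^ r / (r / (r - 1))).
  by rewrite ler_pM2l.
have -> : r * (t `^ r / r + l `^ r / (r / (r - 1))) = t `^ r + (r - 1) * l `^ r.
  by field; rewrite !gt_eqF.
rewrite -e2; lra.
Qed.

Lemma amgm v a b : 0 <= v <= 1 -> 0 <= a -> 0 <= b ->
  a `^ v * b `^ (1 - v) <= v * a + (1 - v) * b.
Proof.
move=> /andP[v0 v1] a0 b0.
have [->|vN0] := eqVneq v 0; first by rewrite powRr0 subr0 powRr1//; lra.
have [->|vN1] := eqVneq v 1; first by rewrite subrr powRr0 powRr1//; lra.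
have v0' : 0 < v by rewrite lt_neqAle eq_sym vN0.
have v1' : 0 < 1 - v by rewrite subr_gt0 lt_neqAle vN1.
have := @conjugate_powR _ (a `^ v) (b `^ (1 - v)) v^-1 (1 - v)^-1 (powR_ge0 _ _) (powR_ge0 _ _).
rewrite !invr_gt0 v0' v1' !invrK => /(_ isT isT) h.
have -> : v * a + (1 - v) * b = a * v + b * (1 - v) by ring.
move: h; rewrite -!powRrM !mulfV ?gt_eqF// !powRr1//; apply; lra.
Qed.

(** The increment of t^k over a step [y] grows with the base point. *)
Lemma exprn_gap_le k x y z : 0 <= y -> 0 <= z -> z <= x ->
  (z + y) ^+ k - z ^+ k <= (x + y) ^+ k - x ^+ k.
Proof.
move=> y0 z0 zx; have x0 : 0 <= x by apply: le_trans zx.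
elim: k => [|k IH]; first by rewrite !expr0 !subrr.
have step u : (u + y) ^+ k.+1 - u ^+ k.+1 = (u + y) * ((u + y) ^+ k - u ^+ k) + y * u ^+ k.
  by rewrite !exprS; ring.
rewrite !step lerD//; last by rewrite ler_wpM2l// lerXn2r.
apply: ler_pM => //; [by rewrite addr_ge0| |by rewrite lerD2r].
by rewrite subr_ge0 lerXn2r ?nnegrE ?addr_ge0// lerDl.
Qed.

(** By induction: multiply the inequality for k by s^2 + t^2; what is left over is
   (s t^(k+1) - t s^(k+1))^2 + (2^(k+1) - 2) (s t)^(k+1) (s - t)^2. *)
Lemma exprn_sqr_gap k s t : 0 <= s -> 0 <= t ->
  (s ^+ k.+1 - t ^+ k.+1) ^+ 2 + (2 * s * t) ^+ k.+1 <= (s ^+ 2 + t ^+ 2) ^+ k.+1.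
Proof.
move=> s0 t0; elim: k => [|k IH]; first by rewrite !expr1; lra.
rewrite [leRHS]exprS; apply: le_trans (ler_wpM2l (addr_ge0 (sqr_ge0 s) (sqr_ge0 t)) IH).
rewrite !(exprS _ k.+1) -subr_ge0.
have st : 0 <= (s * t) ^+ k.+1 by rewrite exprn_ge0 ?mulr_ge0.
have two : 2 <= 2 ^+ k.+1 :> R.
  by rewrite exprS -[leLHS]mulr1 ler_wpM2l// exprn_ege1// ler1n.
rewrite !exprMn; rewrite exprMn in st.
set S := s ^+ k.+1 in st *; set T := t ^+ k.+1 in st *; set K := 2 ^+ k.+1 in two *.
have ->: (s ^+ 2 + t ^+ 2) * ((S - T) ^+ 2 + K * S * T) -
    ((s * S - t * T) ^+ 2 + 2 * s * t * (K * S * T))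
  = (s * T - t * S) ^+ 2 + (K - 2) * (S * T) * (s - t) ^+ 2 .
  ring.
by rewrite addr_ge0 ?sqr_ge0// mulr_ge0 ?sqr_ge0// mulr_ge0// subr_ge0.
Qed.

(** Write v a + (1 - v) b = x + y with x = v (a + b) and y = (1 - 2v) b, and let
   z = 2v sqrt(a b), so that z <= x. By [exprn_gap_le] replacing x by z lowers the
   k-th power of the sum by at least x^k - z^k, which [exprn_sqr_gap] bounds below
   by v^k times the square; and z + y still dominates the weighted geometric
   mean. *)
Lemma refined_young_half v a b k : 0 <= v <= 2^-1 -> 0 <= a -> 0 <= b -> (0 < k)%N ->
  (a `^ v * b `^ (1 - v)) ^+ k + v ^+ k * (a `^ (k%:R / 2) - b `^ (k%:R / 2)) ^+ 2
    <= (v * a + (1 - v) * b) ^+ k.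
Proof.
move=> /andP[v0 v1] a0 b0 k0.
pose s := a `^ 2^-1; pose t := b `^ 2^-1.
have s0 : 0 <= s by apply: powR_ge0.
have t0 : 0 <= t by apply: powR_ge0.
have sq (c : R) : 0 <= c -> (c `^ 2^-1) ^+ 2 = c.
  by move=> c0; rewrite -powR_mulrn ?powR_ge0// -powRrM mulVf// powRr1.
have hk (c : R) : c `^ (k%:R / 2) = (c `^ 2^-1) ^+ k.
  by rewrite mulrC powRrM powR_mulrn ?powR_ge0.
have aE : a = s ^+ 2 by rewrite sq.
have bE : b = t ^+ 2 by rewrite sq.
rewrite !hk -/s -/t.
(* arithmetic-geometric mean with weight 2v on sqrt (a b) and 1 - 2v on b *)
have gm : a `^ v * b `^ (1 - v) <= v * (2 * s * t) + (1 - 2 * v) * b.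
  have v2 : 0 <= 2 * v <= 1 by apply/andP; split; lra.
  apply: le_trans (_ : (s * t) `^ (2 * v) * b `^ (1 - 2 * v) <= _); last first.
    apply: le_trans (amgm v2 (mulr_ge0 s0 t0) b0) _; lra.
  rewrite le_eqVlt; apply/orP; left; apply/eqP.
  rewrite powRM// -!powRrM mulrA mulVf// mul1r -mulrA -powRD; last first.
    by apply/implyP => /eqP; lra.
  by congr (_ * _ `^ _); ring.
have y0 : 0 <= (1 - 2 * v) * b by rewrite mulr_ge0//; lra.
have z0 : 0 <= v * (2 * s * t) by rewrite !mulr_ge0.
have zx : v * (2 * s * t) <= v * (s ^+ 2 + t ^+ 2).
  by rewrite ler_wpM2l//; have := sqr_ge0 (s - t); lra.
have h1 := exprn_gap_le k y0 z0 zx.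
have h2 : (a `^ v * b `^ (1 - v)) ^+ k <= (v * (2 * s * t) + (1 - 2 * v) * b) ^+ k.
  by rewrite lerXn2r ?nnegrE ?addr_ge0// mulr_ge0 ?powR_ge0.
have h3 : v ^+ k * ((s ^+ k - t ^+ k) ^+ 2 + (2 * s * t) ^+ k) <= v ^+ k * (s ^+ 2 + t ^+ 2) ^+ k.
  rewrite ler_wpM2l ?exprn_ge0//; case: k k0 {hk h1 h2} => // k _.
  exact: exprn_sqr_gap.
have -> : v * a + (1 - v) * b = v * (s ^+ 2 + t ^+ 2) + (1 - 2 * v) * b.
  by rewrite -aE -bE; ring.
move: h3 h1 h2; rewrite mulrDr !(exprMn _ v).
set X1 := (_ + _) ^+ k; set X2 := (v * (s ^+ 2 + _) + _) ^+ k.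
lra.
Qed.

Lemma refined_young p q a b k : 1 < p -> 1 < q -> 1 / p + 1 / q = 1 ->
  0 <= a -> 0 <= b -> (0 < k)%N ->
  (a `^ (1 / p) * b `^ (1 / q)) ^+ k
    + Num.min (1 / p) (1 / q) ^+ k * (a `^ (k%:R / 2) - b `^ (k%:R / 2)) ^+ 2
    <= (1 / p * a + 1 / q * b) ^+ k.
Proof.
wlog pq' : p q a b / 1 / p <= 1 / q.
  move=> wl p1 q1 pq a0 b0 k0; have [h|/ltW h] := leP (1 / p) (1 / q).
    by have := wl _ _ a b h p1 q1 pq a0 b0 k0; rewrite min_l.
  have := wl _ _ b a h q1 p1; rewrite addrC => /(_ pq b0 a0 k0).
  rewrite (min_l h) (mulrC (b `^ _)) (addrC (1 / q * b)).
  by rewrite -[(b `^ _ - _) ^+ 2]sqrrN opprB.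
move=> p1 q1 pq a0 b0 k0; rewrite (min_l pq').
have v0 : 0 <= 1 / p by rewrite divr_ge0//; lra.
have qE : 1 / q = 1 - 1 / p by lra.
rewrite qE; apply: refined_young_half => //; rewrite v0/=; lra.
Qed.

(** Convexity of t^r, by its tangent line at the mean. *)
Lemma mean_powR v a b r k : 0 <= v <= 1 -> 0 <= a -> 0 <= b -> 1 <= r ->
  (v * a + (1 - v) * b) ^+ k <= (v * a `^ r + (1 - v) * b `^ r) `^ (k%:R / r).
Proof.
move=> /andP[v0 v1] a0 b0 r1; set l := v * a + (1 - v) * b.
have v1' : 0 <= 1 - v by rewrite subr_ge0.
have l0 : 0 <= l by rewrite addr_ge0 ?mulr_ge0.
have r0 : 0 < r by lra.
have -> : l ^+ k = (l `^ r) `^ (k%:R / r).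
  by rewrite -powRrM mulrCA mulfV ?gt_eqF// mulr1 powR_mulrn.
apply: ge0_ler_powR; rewrite ?nnegrE ?powR_ge0 ?divr_ge0 ?(ltW r0)//.
  by rewrite addr_ge0 ?mulr_ge0 ?powR_ge0.
have ha := ler_wpM2l v0 (powR_tangent r1 a0 l0).
have hb := ler_wpM2l v1' (powR_tangent r1 b0 l0).
apply: le_trans (lerD ha hb); rewrite le_eqVlt; apply/orP; left; apply/eqP.
rewrite /l; ring.
Qed.
End Numeric.

(** * Continuous functions of a positive operator *)

Section Calculus.
Context {R : realType} {H : hilbertType R}.
Implicit Types (x y : H) (a : R) (S T U V : bop H) (p q : {poly R}) (f g : R -> R).

Lemma opnorm_adjoint T : opnorm (adjoint T) <= opnorm T.
Proof.
apply: opnorm_le => [|x]; first exact: opnorm_ge0.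
have [g0|g0] := eqVneq (vnorm (adjoint T x)) 0.
  by rewrite g0 mulr_ge0 ?opnorm_ge0 ?vnorm_ge0.
have gp : 0 < vnorm (adjoint T x) by rewrite lt_neqAle eq_sym g0 vnorm_ge0.
rewrite -(ler_pM2l gp) -expr2 -rdotxx -rdot_adj.
apply: le_trans (rdot_leCS _ _) _; rewrite mulrA (mulrC _ (opnorm T)).
by rewrite ler_wpM2r ?vnorm_ge0 ?opnormP.
Qed.

Lemma adjointB S T : adjoint (S - T) = adjoint S - adjoint T.
Proof. by apply: adjoint_eq => x y; rewrite !bopE !rdotE -!rdot_adj. Qed.

Lemma adjoint_symop T : symop T -> adjoint T = T.
Proof. by move=> Ts; apply: adjoint_eq. Qed.

(** Weierstrass polynomials of f on [0, |T|] are uniformly Cauchy on the spectrum,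
   so [opnorm_poly_spectrum] makes their values at [T] Cauchy in operator norm;
   the same bound shows that the limit does not depend on the polynomials. *)
Lemma fcalc_exists f T : posop T -> nneg_cont f -> exists F, is_fcalc f T F.
Proof.
move=> T0 fc.
have sp t : spectrum T t%:C -> 0 <= t <= opnorm T by exact: posop_spectrum.
have Pn n : exists p : {poly R}, forall t, 0 <= t <= opnorm T -> `|p.[t] - f t| < n.+1%:R^-1.
  by apply: weierstrass => //; rewrite invr_gt0 ltr0n.
have [P PP] := choice Pn.
have close p q d e : 0 <= d -> 0 <= e ->
    (forall t, spectrum T t%:C -> `|p.[t] - f t| <= d) ->
    (forall t, spectrum T t%:C -> `|q.[t] - f t| <= e) ->
    opnorm (poly_op p T - poly_op q T) <= d + e.
  move=> d0 e0 pf qf; rewrite -poly_opB.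
  apply: opnorm_poly_spectrum; [by case: T0|by rewrite addr_ge0|] => t Tt.
  rewrite hornerD hornerN -[p.[t]](subrK (f t)) -addrA.
  apply: le_trans (ler_normD _ _) _; rewrite lerD ?pf// distrC; exact: qf.
have PC n d t : n.+1%:R^-1 <= d -> spectrum T t%:C -> `|(P n).[t] - f t| <= d.
  by move=> nd /sp/(PP n)/ltW h; apply: le_trans nd.
have [|F FP] := @bop_complete _ _ (fun n => poly_op (P n) T).
  move=> e e0; have e20 : 0 < e / 2 by rewrite divr_gt0.
  have [N NP] := invS_small e20; exists N => n m Nn Nm.
  by rewrite [e]splitr; apply: close; rewrite ?(ltW e20)// => t; apply: PC; exact: NP.
exists F => e e0; have e40 : 0 < e / 4 by rewrite divr_gt0.
exists (e / 4) => // p pf.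
have [N NP] := invS_small e40; have [N' N'P] := FP _ e40.
pose n := maxn N N'.
have -> : poly_op p T - F = (poly_op p T - poly_op (P n) T) + (poly_op (P n) T - F).
  by rewrite subrKA.
apply: le_lt_trans (opnormD _ _) _.
have h1 : opnorm (poly_op p T - poly_op (P n) T) <= e / 4 + e / 4.
  apply: close; rewrite ?(ltW e40)// => t Tt; first exact/ltW/pf.
  by apply: PC Tt; apply: NP; rewrite leq_maxl.
have h2 := N'P n (leq_maxr _ _); lra.
Qed.

Lemma fcalcP f T : posop T -> nneg_cont f -> is_fcalc f T (fcalc f T).
Proof. by move=> T0 fc; apply: (xgetPex 0); exact: fcalc_exists. Qed.

Lemma fcalc_approx f T e : posop T -> nneg_cont f -> 0 < e ->
  exists2 d, 0 < d & forall p, (forall t, 0 <= t <= opnorm T -> `|p.[t] - f t| < d) ->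
    opnorm (poly_op p T - fcalc f T) < e.
Proof.
move=> T0 fc e0; have [d d0 dP] := fcalcP T0 fc e0; exists d => // p pf.
by apply: dP => t /(posop_spectrum T0); exact: pf.
Qed.

(** Polynomials approximating f on the whole of [0, |T|] exist, so two limits of
   the calculus coincide; it is enough that, at every scale, one such polynomial
   has its value at [T] close to [F]. *)
Lemma fcalc_eq f T F K : posop T -> nneg_cont f -> 0 <= K ->
  (forall e, 0 < e -> e <= 1 -> exists p,
     (forall t, 0 <= t <= opnorm T -> `|p.[t] - f t| <= K * e) /\
     opnorm (poly_op p T - F) <= K * e) ->
  fcalc f T = F.
Proof.
move=> T0 fc K0 h; apply/eqP; rewrite -subr_eq0; apply/eqP/opnorm_small.
exists (1 + K) => e e0 e1.
have [d d0 dP] := fcalc_approx T0 fc e0.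
have K1 : 0 < K + 1 by rewrite ltr_wpDl.
have d'0 : 0 < d / (K + 1) by rewrite divr_gt0.
pose e' := Num.min e (d / (K + 1)).
have e'0 : 0 < e' by rewrite lt_min e0.
have e'e : e' <= e by rewrite ge_min lexx.
have e'd : e' <= d / (K + 1) by rewrite ge_min lexx orbT.
have [p [pf pF]] := h e' e'0 (le_trans e'e e1).
have -> : fcalc f T - F = - (poly_op p T - fcalc f T) + (poly_op p T - F).
  by rewrite opprB subrKA.
apply: le_trans (opnormD _ _) _; rewrite opnormN mulrDl mul1r lerD//.
  apply/ltW/dP => t /pf/le_lt_trans; apply.
  apply: (@le_lt_trans _ _ (K * (d / (K + 1)))); first by rewrite ler_wpM2l.
  rewrite mulrA ltr_pdivrMr// mulrC ltr_pM2l//; lra.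
by apply: le_trans pF _; rewrite ler_wpM2l.
Qed.

Lemma fcalc_near_poly f T e : posop T -> nneg_cont f -> 0 < e ->
  exists2 p, (forall t, 0 <= t <= opnorm T -> `|p.[t] - f t| <= e) &
    opnorm (poly_op p T - fcalc f T) <= e.
Proof.
move=> T0 fc e0; have [d d0 dP] := fcalc_approx T0 fc e0.
have m0 : 0 < Num.min d e by rewrite lt_min d0.
have [p pP] := weierstrass (opnorm T) fc m0; exists p.
  by move=> t /pP; rewrite lt_min => /andP[_ /ltW].
by apply/ltW/dP => t /pP; rewrite lt_min => /andP[].
Qed.

Lemma fcalc_poly p T : posop T -> fcalc (fun t => p.[t]) T = poly_op p T.
Proof.
move=> T0; apply: (@fcalc_eq _ _ _ 0) => //; first exact: nneg_cont_poly.
move=> e _ _; exists p; split; first by move=> t _; rewrite subrr normr0 mul0r.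
by rewrite subrr opnorm0 mul0r.
Qed.

(** The spectrum of a positive operator has no negative real point. *)
Lemma fcalc_ext f g T : posop T -> (forall t, 0 <= t -> f t = g t) ->
  fcalc f T = fcalc g T.
Proof.
move=> T0 fg; congr (xget _ _); apply/seteqP.
have sub f' g' : (forall t, 0 <= t -> f' t = g' t) -> [set F | is_fcalc f' T F] `<=` [set F | is_fcalc g' T F].
  move=> fg' F FP e e0; have [d d0 dP] := FP e e0; exists d => // p pg.
  by apply: dP => t Tt; rewrite fg' ?pg//; have /andP[] := posop_spectrum T0 Tt.
by split; apply: sub => // t t0; rewrite fg.
Qed.

Lemma fcalc_id T : posop T -> fcalc id T = T.
Proof.
move=> T0; rewrite -[RHS](poly_opX T) -fcalc_poly//.
by apply: fcalc_ext => // t _; rewrite hornerX.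
Qed.

Lemma fcalc_cst a T : posop T -> fcalc (fun=> a) T = a%:C *: (1 : bop H).
Proof.
move=> T0; rewrite -(poly_opC a T) -fcalc_poly//.
by apply: fcalc_ext => // t _; rewrite hornerC.
Qed.

Lemma fcalc_lin a f g T : posop T -> nneg_cont f -> nneg_cont g ->
  fcalc (fun t => a * f t + g t) T = a%:C *: fcalc f T + fcalc g T.
Proof.
move=> T0 fc gc; apply: (@fcalc_eq _ _ _ (`|a| + 1)) => //.
  by apply: nneg_contD => //; apply: nneg_contM => //; exact: nneg_cont_cst.
move=> e e0 _.
have [p pf pF] := fcalc_near_poly T0 fc e0; have [q qg qG] := fcalc_near_poly T0 gc e0.
exists (a *: p + q); split.
  move=> t tT; rewrite !hornerE.
  have -> : a * p.[t] + q.[t] - (a * f t + g t) = a * (p.[t] - f t) + (q.[t] - g t) by ring.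
  apply: le_trans (ler_normD _ _) _; rewrite normrM mulrDl mul1r.
  by rewrite lerD ?ler_wpM2l ?pf ?qg.
have -> : poly_op (a *: p + q) T - (a%:C *: fcalc f T + fcalc g T)
  = a%:C *: (poly_op p T - fcalc f T) + (poly_op q T - fcalc g T).
  by rewrite poly_opD poly_opZ scalerBr opprD addrACA.
apply: le_trans (opnormD _ _) _; rewrite mulrDl mul1r lerD//.
by apply: le_trans (opnormZ _ _) _; rewrite ler_wpM2l.
Qed.

Lemma nneg_cont_bounded f (N : R) : 0 <= N -> nneg_cont f ->
  exists2 B, 0 <= B & forall t, 0 <= t <= N -> `|f t| <= B.
Proof.
move=> N0 fc.
have [|K _ KP] := @EVT_max R (fun t => `|f (Num.max 0 t)|) 0 N N0.
  by apply: continuous_subspaceT => x; apply: cvg_norm; exact: fc.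
exists `|f (Num.max 0 K)| => // t /[dup] tN /andP[t0 _].
by have := KP t; rewrite in_itv/= tN => /(_ isT); rewrite max_r.
Qed.

Lemma fcalc_mul f g T : posop T -> nneg_cont f -> nneg_cont g ->
  fcalc (fun t => f t * g t) T = fcalc f T * fcalc g T.
Proof.
move=> T0 fc gc.
have [A A0 fA] := nneg_cont_bounded (opnorm_ge0 T) fc.
have [B B0 gB] := nneg_cont_bounded (opnorm_ge0 T) gc.
set F := fcalc f T; set G := fcalc g T.
have F0 := opnorm_ge0 F; have G0 := opnorm_ge0 G.
apply: (@fcalc_eq _ _ _ (1 + A + B + opnorm F + opnorm G)).
- by [].
- exact: nneg_contM.
- by rewrite !addr_ge0.
move=> e e0 e1.
have [p pf pF] := fcalc_near_poly T0 fc e0; have [q qg qG] := fcalc_near_poly T0 gc e0.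
have bnd (a b c d : R) : 0 <= a -> 0 <= b -> 0 <= c -> 0 <= d ->
    e * e + c * e + d * e <= (1 + a + b + c + d) * e.
  move=> a0 b0 c0 d0; have := mulr_ge0 a0 (ltW e0); have := mulr_ge0 b0 (ltW e0).
  have : e * e <= 1 * e by rewrite ler_wpM2r ?(ltW e0).
  lra.
exists (p * q); split.
  move=> t tT; rewrite hornerM.
  have -> : p.[t] * q.[t] - f t * g t =
    (p.[t] - f t) * (q.[t] - g t) + (f t * (q.[t] - g t) + (p.[t] - f t) * g t) by ring.
  apply: le_trans (ler_normD _ _) _; rewrite !normrM.
  apply: le_trans (lerD (lexx _) (ler_normD _ _)) _; rewrite !normrM addrA.
  apply: (@le_trans _ _ (e * e + A * e + e * B)).
    by rewrite !lerD// ler_pM// ?pf ?qg ?fA ?gB.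
  have := bnd _ _ _ _ F0 G0 A0 B0; lra.
have -> : poly_op (p * q) T - F * G =
    (poly_op p T - F) * (poly_op q T - G) + (F * (poly_op q T - G) + (poly_op p T - F) * G).
  by rewrite poly_opM [X in _ = _ + X]addrC addrA -mulrDr subrK mulrBl mulrBr subrKA.
apply: le_trans (opnormD _ _) _.
apply: le_trans (lerD (opnormM _ _) (opnormD _ _)) _.
apply: le_trans (lerD (lexx _) (lerD (opnormM _ _) (opnormM _ _))) _; rewrite addrA.
apply: (@le_trans _ _ (e * e + opnorm F * e + e * opnorm G)).
  by rewrite !lerD// ler_pM// ?opnorm_ge0.
have := bnd _ _ _ _ A0 B0 F0 G0; lra.
Qed.

(** Taking adjoints is norm-continuous and fixes p(T), so it also fixes the limit. *)
Lemma fcalc_sym f T : posop T -> nneg_cont f -> symop (fcalc f T).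
Proof.
move=> T0 fc; suff FE : fcalc f T = adjoint (fcalc f T).
  by move=> x y; rewrite rdot_adj -FE.
apply: (@fcalc_eq _ _ _ 1) => // e e0 _.
have [p pf pF] := fcalc_near_poly T0 fc e0.
exists p; split; first by move=> t tT; rewrite mul1r pf.
rewrite mul1r -(@adjoint_symop (poly_op p T)); last by apply: symop_poly; case: T0.
by rewrite -adjointB; apply: le_trans (opnorm_adjoint _) pF.
Qed.

(** f(T) is the square of the self-adjoint operator (sqrt f)(T). *)
Lemma fcalc_pos f T : posop T -> nneg_cont f -> (forall t, 0 <= t -> 0 <= f t) ->
  posop (fcalc f T).
Proof.
move=> T0 fc f0; split=> [|x]; first exact: fcalc_sym.
have sc := nneg_cont_sqrt fc.
have -> : fcalc f T = fcalc (fun t => Num.sqrt (f t)) T * fcalc (fun t => Num.sqrt (f t)) T.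
  rewrite -fcalc_mul//; apply: fcalc_ext => // t t0.
  by rewrite -expr2 sqr_sqrtr ?f0.
by rewrite bopME fcalc_sym// rdotxx sqr_ge0.
Qed.

(** Positivity of (c^2 - f^2)(T). *)
Lemma fcalc_bound f T (c : R) x : posop T -> nneg_cont f -> 0 <= c ->
  (forall t, 0 <= t -> `|f t| <= c) -> vnorm (fcalc f T x) <= c * vnorm x.
Proof.
move=> T0 fc c0 fb.
have f2 := nneg_contM fc fc.
have h : nneg_cont (fun t => -1 * (f t * f t) + c ^+ 2).
  apply: nneg_contD; last exact: nneg_cont_cst.
  by apply: nneg_contM => //; exact: nneg_cont_cst.
have [|_ /(_ x)] := @fcalc_pos _ T T0 h.
  move=> t t0; rewrite mulN1r addrC subr_ge0 -expr2 -[leLHS]real_normK ?num_real//.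
  by rewrite ler_sqr ?nnegrE ?fb.
rewrite fcalc_lin//; last exact: nneg_cont_cst.
rewrite fcalc_mul// fcalc_cst// !bopE !rdotE fcalc_sym// !rdotxx.
rewrite mulN1r addrC subr_ge0 -exprMn ler_sqr ?nnegrE ?mulr_ge0 ?vnorm_ge0//.
Qed.

(** True for polynomials; one polynomial approximates f on a segment that
   contains both spectra. *)
Lemma fcalc_intertwine f V S T : posop S -> posop T -> nneg_cont f ->
  V * S = T * V -> V * fcalc f S = fcalc f T * V.
Proof.
move=> S0 T0 fc VST; apply/eqP; rewrite -subr_eq0; apply/eqP/opnorm_small.
exists (opnorm V + opnorm V) => e e0 _.
have [d d0 dP] := fcalc_approx S0 fc e0; have [d' d'0 d'P] := fcalc_approx T0 fc e0.
have m0 : 0 < Num.min d d' by rewrite lt_min d0.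
have [p pP] := weierstrass (Num.max (opnorm S) (opnorm T)) fc m0.
have h1 : opnorm (poly_op p S - fcalc f S) <= e.
  apply/ltW/dP => t /andP[t0 tS]; have := pP t.
  by rewrite t0 le_max tS => /(_ isT); rewrite lt_min => /andP[].
have h2 : opnorm (poly_op p T - fcalc f T) <= e.
  apply/ltW/d'P => t /andP[t0 tS]; have := pP t.
  by rewrite t0 le_max tS orbT => /(_ isT); rewrite lt_min => /andP[].
have -> : V * fcalc f S - fcalc f T * V =
    - (V * (poly_op p S - fcalc f S)) + (poly_op p T - fcalc f T) * V.
  by rewrite mulrBr mulrBl (poly_op_intertwine p VST) opprB subrKA.
apply: le_trans (opnormD _ _) _; rewrite opnormN [leRHS]mulrDl.
apply: lerD; apply: le_trans (opnormM _ _) _.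
  by rewrite ler_wpM2l ?opnorm_ge0.
by rewrite mulrC ler_wpM2l ?opnorm_ge0.
Qed.

(** The Holder-McCarthy inequality: apply the calculus to the tangent line
   inequality for t^r at l = <f(T)x, x>, and evaluate at the unit vector [x], where
   the linear term vanishes. *)
Lemma fcalc_jensen f T r x : posop T -> nneg_cont f -> (forall t, 0 <= t -> 0 <= f t) ->
  1 <= r -> vnorm x = 1 ->
  rdot (fcalc f T x) x `^ r <= rdot (fcalc (fun t => f t `^ r) T x) x.
Proof.
move=> T0 fc f0 r1 x1; set l := rdot (fcalc f T x) x.
have l0 : 0 <= l by have [_] := fcalc_pos T0 fc f0; apply.
have r0 : 0 < r by lra.
have rc : nneg_cont (fun t => f t `^ r) by exact: nneg_cont_powR.
set b := r * l `^ (r - 1); set c := l `^ r - b * l.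
have cc : nneg_cont (fun=> - c) by exact: nneg_cont_cst.
have cc1 : nneg_cont (fun=> 1 : R) by exact: nneg_cont_cst.
have fcc : nneg_cont (fun t => - b * f t + - c).
  by apply: nneg_contD => //; apply: nneg_contM => //; exact: nneg_cont_cst.
have gc : nneg_cont (fun t => 1 * f t `^ r + (- b * f t + - c)).
  by apply: nneg_contD => //; apply: nneg_contM.
have [|_ /(_ x)] := @fcalc_pos _ T T0 gc.
  by move=> t t0; have := powR_tangent r1 (f0 _ t0) l0; rewrite /c -/b; lra.
rewrite !fcalc_lin// fcalc_cst// !bopE !rdotE -/l rdotxx x1 /c; lra.
Qed.
End Calculus.

(** * The mixed Schwarz inequality *)

Section MixedSchwarz.
Context {R : realType} {H : hilbertType R}.
Implicit Types (x y u v : H) (A S T U V : bop H) (f g : R -> R).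

Lemma nneg_cont_sqrtr : nneg_cont (Num.sqrt : R -> R).
Proof. exact: nneg_cont_sqrt nneg_cont_id. Qed.

Lemma posop_adjM A : posop (adjoint A * A).
Proof. by have := posop_conj A posop1; rewrite mulr1. Qed.

Lemma absop_pos A : posop (absop A).
Proof.
apply: fcalc_pos; [exact: posop_adjM|exact: nneg_cont_sqrtr|].
by move=> t _; exact: sqrtr_ge0.
Qed.

Lemma absop_sqr A : absop A * absop A = adjoint A * A.
Proof.
have P0 := posop_adjM A.
rewrite /absop -fcalc_mul//; try exact: nneg_cont_sqrtr.
rewrite -[RHS](fcalc_id P0).
by apply: fcalc_ext => // t t0; rewrite -expr2 sqr_sqrtr.
Qed.

(** Both squares are <|A|^2 x, x>. With this identity, |A| can be exchanged for [A]
   under the norm without a partial isometry between their ranges. *)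
Lemma vnorm_absop A x : vnorm (absop A x) = vnorm (A x).
Proof.
apply/eqP; rewrite -(@eqrXn2 _ 2) ?vnorm_ge0//; apply/eqP.
have [As _] := absop_pos A.
by rewrite -!rdotxx As -bopME absop_sqr bopME -rdot_adj.
Qed.

(** With A' the adjoint of [A], this follows from A (A' A) = (A A') A, first for
   the square roots and then for functions of them. *)
Lemma absop_intertwine A f : nneg_cont f ->
  A * fcalc f (absop A) = fcalc f (absop (adjoint A)) * A.
Proof.
move=> fc; apply: fcalc_intertwine => //; try exact: absop_pos.
apply: fcalc_intertwine; try exact: posop_adjM; first exact: nneg_cont_sqrtr.
by rewrite adjointK mulrA.
Qed.

(** Let U = A (|A| + e)^-1. It is a contraction, since |U x| = ||A| (|A| + e)^-1 x|,
   and A = U |A| + e U. In U |A| = U psi(|A|) phi(|A|) the factor psi(|A|) crosses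
   [U], becoming psi of the modulus of the adjoint, and moves to the other side of
   the inner product. Cauchy-Schwarz gives the claim up to e |u| |v|. The
   contraction [U] stands for the partial isometry of the polar decomposition. *)
Lemma mixed_schwarz_real (psi phi : R -> R) A u v :
  nneg_cont psi -> nneg_cont phi -> (forall t, 0 <= t -> psi t * phi t = t) ->
  rdot (A u) v <= vnorm (fcalc phi (absop A) u) * vnorm (fcalc psi (absop (adjoint A)) v).
Proof.
move=> psic phic psiphi; set P := absop A.
have P0 : posop P := absop_pos A.
have Q0 : posop (absop (adjoint A)) := absop_pos _.
set F := fcalc phi P; set G := fcalc psi (absop (adjoint A)).
set K := vnorm u * vnorm v.
have K0 : 0 <= K by rewrite mulr_ge0 ?vnorm_ge0.
suff key e : 0 < e -> rdot (A u) v <= vnorm (F u) * vnorm (G v) + e * K.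
  apply/ler_addgt0Pr => e e0; have K1 : 0 < K + 1 by rewrite ltr_wpDl.
  apply: le_trans (key (e / (K + 1)) _) _; first exact: divr_gt0.
  by rewrite lerD2l mulrAC ler_pdivrMr// ler_pM2l// lerDl.
move=> e0; pose h t := (t + e)^-1.
have hc : nneg_cont h.
  apply: nneg_cont_inv => [t t0|]; first by rewrite gt_eqF// ltr_wpDl.
  by apply: nneg_contD; [exact: nneg_cont_id|exact: nneg_cont_cst].
have idc : nneg_cont (id : R -> R) by exact: nneg_cont_id.
pose h_ := fcalc h P; pose U := A * h_.
have UG f : nneg_cont f -> U * fcalc f P = fcalc f (absop (adjoint A)) * U.
  move=> fc; rewrite /U -mulrA -fcalc_mul// mulrA -absop_intertwine// -mulrA -fcalc_mul//.
  by congr (_ * _); apply: fcalc_ext => // t _; rewrite mulrC.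
have Ucontr x : vnorm (U x) <= vnorm x.
  have Ph : P * h_ = fcalc (fun t => t * h t) P by rewrite (fcalc_mul P0 idc hc) fcalc_id.
  rewrite /U bopME -vnorm_absop -/P -bopME Ph.
  rewrite -[leRHS]mul1r; apply: fcalc_bound => //; first exact: nneg_contM.
  move=> t t0; rewrite /h ger0_norm ?ler_pdivrMr ?ltr_wpDl ?divr_ge0 ?addr_ge0 ?(ltW e0)//.
  by rewrite mul1r lerDl ltW.
have PE : P = fcalc psi P * fcalc phi P.
  rewrite -fcalc_mul// -[LHS](fcalc_id P0); apply: fcalc_ext => // t t0.
  by rewrite psiphi.
have AE : A = U * P + e%:C *: U.
  have hP : h_ * P + e%:C *: h_ = 1.
    have -> : h_ * P = fcalc (fun t => h t * t) P by rewrite (fcalc_mul P0 hc idc) fcalc_id.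
    rewrite addrC -fcalc_lin//; last exact: nneg_contM.
    rewrite (@fcalc_ext _ _ _ (fun=> 1)) ?fcalc_cst ?rmorph1 ?scale1r// => t t0.
    by rewrite /h; field; rewrite gt_eqF// ltr_wpDl.
  by rewrite -[LHS]mulr1 -hP mulrDr mulrA bop_scaleMr.
rewrite {1}AE bopDE rdotDl; apply: lerD.
  rewrite PE mulrA UG// !bopME fcalc_sym//.
  apply: le_trans (rdot_leCS _ _) _.
  by rewrite ler_wpM2r ?vnorm_ge0 ?Ucontr.
rewrite bopZE rdotZl ler_pM2l//; apply: le_trans (rdot_leCS _ _) _.
by rewrite ler_wpM2r ?vnorm_ge0 ?Ucontr.
Qed.

(** Multiplying [u] by the conjugate of <Au, v> makes the left-hand side real. *)
Lemma mixed_schwarz (psi phi : R -> R) A u v :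
  nneg_cont psi -> nneg_cont phi -> (forall t, 0 <= t -> psi t * phi t = t) ->
  complex.Re `|'[< A u, v >]| ^+ 2 <=
    rdot (fcalc (fun t => psi t ^+ 2) (absop (adjoint A)) v) v *
    rdot (fcalc (fun t => phi t ^+ 2) (absop A) u) u.
Proof.
move=> psic phic psiphi.
have sq f S x : posop S -> nneg_cont f ->
    rdot (fcalc (fun t => f t ^+ 2) S x) x = vnorm (fcalc f S x) ^+ 2.
  move=> S0 fc; rewrite -rdotxx -[RHS]fcalc_sym// -bopME -fcalc_mul//.
rewrite !sq//; try exact: absop_pos.
rewrite -exprMn ler_sqr; [|by rewrite nnegrE -ler0c RRe_real ?normr_real|by rewrite nnegrE mulr_ge0 ?vnorm_ge0].
set z := '[< A u, v >]; set c := complex.Re `|z|.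
have cE : `|z| = c%:C by rewrite /c RRe_real ?normr_real.
have [c0|c0] := eqVneq c 0; first by rewrite c0 mulr_ge0 ?vnorm_ge0.
have cp : 0 < c by rewrite lt_neqAle eq_sym c0 -ler0c -cE normr_ge0.
have := @mixed_schwarz_real psi phi A (Num.conj z *: u) v psic phic psiphi.
rewrite !bop_scale vnormZ norm_conjC -/c /rdot linearZl_LR/= -/z mulrC -normCK cE.
by rewrite -rmorphXn /= expr2 -mulrA ler_pM2l// [X in _ <= X -> _]mulrC.
Qed.
End MixedSchwarz.

(** * The numerical radius bound *)

(** The tangent line of t^(k+1) at the mean of the u i, summed over i: its
   linear terms cancel. *)
Lemma exprn_sum_le (R : realType) (n k : nat) (u : 'I_n -> R) :
  (0 < n)%N -> (forall i, 0 <= u i) ->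
  (\sum_i u i) ^+ k.+1 <= n%:R ^+ k * \sum_i u i ^+ k.+1.
Proof.
move=> n0 u0; have nR : 0 < n%:R :> R by rewrite ltr0n.
set s := \sum_i u i; pose l := s / n%:R.
have l0 : 0 <= l by rewrite divr_ge0 ?ler0n// sumr_ge0.
pose b := k.+1%:R * l `^ (k.+1%:R - 1).
have h i : l ^+ k.+1 + b * (u i - l) <= u i ^+ k.+1.
  have := @powR_tangent _ k.+1%:R (u i) l _ (u0 i) l0.
  by rewrite !powR_mulrn//; apply; rewrite ler1n.
have : \sum_(i < n) (l ^+ k.+1 + b * (u i - l)) <= \sum_i u i ^+ k.+1.
  by apply: ler_sum => i _.
rewrite big_split/= -mulr_sumr sumrB !sumr_const !card_ord -/s.
have -> : s - l *+ n = 0.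
  by rewrite -mulr_natr /l divfK ?subrr// gt_eqF.
rewrite mulr0 addr0 => h'.
apply: le_trans (ler_wpM2l (exprn_ge0 k (ltW nR)) h').
rewrite le_eqVlt; apply/orP; left; apply/eqP.
by rewrite -[l ^+ _ *+ n]mulr_natr mulrCA -exprSr -exprMn divfK// gt_eqF.
Qed.

(** The contribution of one pair (S, T). Put a = <S^p x, x> and b = <T^q x, x>. The
   Holder-McCarthy inequality gives <Sx, x> <= a^(1/p) and <Tx, x> <= b^(1/q); the
   refined Young inequality for a and b produces the square and the k-th power of
   a/p + b/q. The power mean inequality replaces a/p + b/q by the r-th root of
   a^r/p + b^r/q, and Holder-McCarthy bounds a^r by <S^(p r) x, x> and b^r by
   <T^(q r) x, x>. *)
Lemma schwarz_refined_young (R : realType) (H : hilbertType R) (S T : bop H)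
  (p q r c : R) (k : nat) (x : H) : posop S -> posop T ->
  1 < p -> 1 < q -> 1 / p + 1 / q = 1 -> 1 <= r -> (0 < k)%N -> vnorm x = 1 ->
  0 <= c -> c ^+ 2 <= rdot (S x) x * rdot (T x) x ->
  c ^+ (2 * k) <=
    opnorm ((1 / p)%:C *: powop S (p * r) + (1 / q)%:C *: powop T (q * r)) `^ (k%:R / r)
    - Num.min (1 / p) (1 / q) ^+ k *
      (rdot (powop S p x) x `^ (k%:R / 2) - rdot (powop T q x) x `^ (k%:R / 2)) ^+ 2.
Proof.
move=> S0 T0 p1 q1 pq r1 k0 x1 c0 cST.
have Sx : 0 <= rdot (S x) x by case: S0.
have Tx : 0 <= rdot (T x) x by case: T0.
have p0 : 0 < p by lra.
have q0 : 0 < q by lra.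
have r0 : 0 < r by lra.
have pw0 U s : posop U -> 0 < s -> 0 <= rdot (powop U s x) x.
  move=> U0 s0; have [_] := @fcalc_pos _ _ (fun t => t `^ s) U U0
    (nneg_cont_powR s0 (fun t t0 => t0) nneg_cont_id) (fun t _ => powR_ge0 t s).
  exact.
set a := rdot (powop S p x) x; set b := rdot (powop T q x) x.
have a0 : 0 <= a by exact: pw0.
have b0 : 0 <= b by exact: pw0.
have mc U s : posop U -> 1 < s -> 0 <= rdot (U x) x ->
    rdot (U x) x <= rdot (powop U s x) x `^ (1 / s).
  move=> U0 s1 Ux; have s0 : 0 < s by lra.
  have := @fcalc_jensen _ _ id U s x U0 nneg_cont_id (fun t t0 => t0) (ltW s1) x1.
  rewrite fcalc_id// => h.
  rewrite div1r -[leLHS]powRr1// -(mulfV (lt0r_neq0 s0)) powRrM.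
  apply: ge0_ler_powR => //; rewrite ?nnegrE ?powR_ge0 ?invr_ge0 ?(ltW s0)//.
  exact: pw0.
have mr U s : posop U -> 1 < s ->
    rdot (powop U s x) x `^ r <= rdot (powop U (s * r) x) x.
  move=> U0 s1; have s0 : 0 < s by lra.
  have sc : nneg_cont (fun t : R => t `^ s).
    exact: (nneg_cont_powR s0 (fun t t0 => t0) nneg_cont_id).
  have -> : powop U (s * r) = fcalc (fun t => (t `^ s) `^ r) U.
    by apply: fcalc_ext => // t _; rewrite powRrM.
  exact: (fcalc_jensen U0 sc (fun t _ => powR_ge0 t s) r1 x1).
have h1 : c ^+ (2 * k) <= (a `^ (1 / p) * b `^ (1 / q)) ^+ k.
  rewrite exprM; apply: lerXn2r; rewrite ?nnegrE ?sqr_ge0 ?mulr_ge0 ?powR_ge0//.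
  by apply: le_trans cST _; apply: ler_pM => //; exact: mc.
have h2 := refined_young p1 q1 pq a0 b0 k0.
have v01 : 0 <= 1 / p <= 1.
  by rewrite divr_ge0 ?(ltW p0) ?ler01//= ler_pdivrMr// mul1r (ltW p1).
have qE : 1 / q = 1 - 1 / p by lra.
have h3 := mean_powR k v01 a0 b0 r1; rewrite -qE in h3.
rewrite lerBrDr; apply: le_trans (lerD h1 (lexx _)) _.
apply: le_trans h2 _; apply: le_trans h3 _.
have pi0 : 0 <= 1 / p by case/andP: v01.
have qi0 : 0 <= 1 / q by rewrite divr_ge0 ?(ltW q0).
apply: ge0_ler_powR; rewrite ?nnegrE ?opnorm_ge0 ?divr_ge0 ?ler0n ?(ltW r0)//.
  by apply: addr_ge0; apply: mulr_ge0 => //; exact: powR_ge0.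
set C := _ + _ *: _.
apply: le_trans (_ : rdot (C x) x <= _).
  by rewrite /C !bopE !rdotE; apply: lerD; apply: ler_wpM2l => //; exact: mr.
apply: le_trans (rdot_leCS _ _) _; rewrite x1 mulr1.
by have := opnormP C x; rewrite x1 mulr1.
Qed.

Theorem theorem3p17 (R : realType) (H : hilbertType R) (n m k : nat)
    (n1 : (1 <= n)%N) (m1 : (1 <= m)%N) (k1 : (1 <= k)%N)
    (A B X : 'I_n -> bop H) (p q : R) (p1 : 1 < p) (q1 : 1 < q)
    (pq : 1 / p + 1 / q = 1) (psi phi : R -> R)
    (psi_ge0 : forall t, 0 <= t -> 0 <= psi t)
    (phi_ge0 : forall t, 0 <= t -> 0 <= phi t)
    (psi_cont : {within `[0, +oo[, continuous psi})
    (phi_cont : {within `[0, +oo[, continuous phi})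
    (psi_phi : forall t, 0 <= t -> psi t * phi t = t)
    (r : R) (r1 : 1 <= r) :
  let r0 := Num.min (1 / p) (1 / q) in
  let S i j := X i * fcalc (fun t => psi t ^+ 2) (absop (adjoint (A i ^+ j)))
                 * adjoint (X i) in
  let T i j := adjoint (A i ^+ (m - j) * B i)
                 * fcalc (fun t => phi t ^+ 2) (absop (A i ^+ j))
                 * (A i ^+ (m - j) * B i) in
  let omega (x : H) := n%:R ^+ (2 * k - 1) / m%:R *
    \sum_(1 <= j < m.+1) \sum_(i < n)
      (complex.Re '[< powop (S i j) p x, x >] `^ (k%:R / 2)
       - complex.Re '[< powop (T i j) q x, x >] `^ (k%:R / 2)) ^+ 2 in
  numradius (\sum_(i < n) X i * A i ^+ m * B i) ^+ (2 * k) <=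
    n%:R ^+ (2 * k - 1) / m%:R *
      \sum_(1 <= j < m.+1) \sum_(i < n)
        opnorm ((1 / p)%:C *: powop (S i j) (p * r)
                + (1 / q)%:C *: powop (T i j) (q * r)) `^ (k%:R / r)
    - r0 ^+ k * inf [set omega x | x in [set x : H | `|x| = 1]].
Proof.
pose r0 := Num.min (1 / p) (1 / q).
pose S i j := X i * fcalc (fun t => psi t ^+ 2) (absop (adjoint (A i ^+ j)))
                 * adjoint (X i).
pose T i j := adjoint (A i ^+ (m - j) * B i)
                 * fcalc (fun t => phi t ^+ 2) (absop (A i ^+ j))
                 * (A i ^+ (m - j) * B i).
pose N := n%:R ^+ (2 * k - 1) : R.
pose E i j := opnorm ((1 / p)%:C *: powop (S i j) (p * r)
                + (1 / q)%:C *: powop (T i j) (q * r)) `^ (k%:R / r).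
pose D x i j := (rdot (powop (S i j) p x) x `^ (k%:R / 2)
       - rdot (powop (T i j) q x) x `^ (k%:R / 2)) ^+ 2.
pose omega x := N / m%:R * \sum_(1 <= j < m.+1) \sum_(i < n) D x i j.
pose W := \sum_(i < n) X i * A i ^+ m * B i.
pose RHS := N / m%:R * \sum_(1 <= j < m.+1) \sum_(i < n) E i j
  - r0 ^+ k * inf [set omega x | x in [set x : H | `|x| = 1]].
change (is_true (numradius W ^+ (2 * k) <= RHS)).
have psic := nneg_cont_within psi_cont; have phic := nneg_cont_within phi_cont.
have sq_pos (f : R -> R) (P : bop H) : posop P -> nneg_cont f -> posop (fcalc (fun t => f t ^+ 2) P).
  move=> P0 fc; apply: fcalc_pos => [//||t _]; [exact: nneg_contM|exact: sqr_ge0].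
have S0 i j : posop (S i j).
  have := posop_conj (adjoint (X i)) (sq_pos psi _ (absop_pos (adjoint (A i ^+ j))) psic).
  by rewrite adjointK.
have T0 i j : posop (T i j).
  exact: (posop_conj _ (sq_pos phi _ (absop_pos (A i ^+ j)) phic)).
have N0 : 0 <= N by rewrite exprn_ge0 ?ler0n.
have mR : 0 < m%:R :> R by rewrite ltr0n.
have Nm0 : 0 <= N / m%:R by rewrite divr_ge0 ?(ltW mR).
have r00 : 0 <= r0 ^+ k.
  by rewrite exprn_ge0// le_min !divr_ge0//; lra.
have omega_ge0 x : 0 <= omega x.
  apply: mulr_ge0 => //; apply: sumr_ge0 => j _; apply: sumr_ge0 => i _.
  exact: sqr_ge0.
pose w x := complex.Re `|'[< W x, x >]|.
have w0 x : 0 <= w x by rewrite -ler0c RRe_real ?normr_real.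
have infP x : vnorm x = 1 -> inf [set omega x | x in [set x : H | `|x| = 1]] <= omega x.
  move=> x1; apply: ge_inf; first by exists 0 => _ [y _ <-].
  by exists x => //=; rewrite vnormE x1.
have pointwise x : vnorm x = 1 -> w x ^+ (2 * k) <= RHS.
  move=> x1; pose u i := complex.Re `|'[< (X i * A i ^+ m * B i) x, x >]|.
  have u0 i : 0 <= u i by rewrite -ler0c RRe_real ?normr_real.
  have wu : w x <= \sum_i u i.
    rewrite -lecR raddf_sum/= /w RRe_real ?normr_real//.
    rewrite bop_sumE linear_sumlz; apply: le_trans (ler_norm_sum _ _ _) _.
    by apply: ler_sum => i _; rewrite RRe_real ?normr_real.
  have uED i j : (j <= m)%N -> u i ^+ (2 * k) <= E i j - r0 ^+ k * D x i j.
    move=> jm; apply: schwarz_refined_young => //.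
    have := @mixed_schwarz _ _ psi phi (A i ^+ j) ((A i ^+ (m - j) * B i) x)
      (adjoint (X i) x) psic phic psi_phi.
    rewrite -[X in X <= _ -> _]/(complex.Re _ ^+ 2).
    have -> : '[< (A i ^+ j) ((A i ^+ (m - j) * B i) x), adjoint (X i) x >]
      = '[< (X i * A i ^+ m * B i) x, x >].
      have Am : A i ^+ m = A i ^+ j * A i ^+ (m - j) by rewrite -exprD subnKC.
      by rewrite -adjointP !bopME Am bopME.
    move=> h; apply: le_trans h _; rewrite le_eqVlt; apply/orP; left; apply/eqP.
    by congr (_ * _); rewrite !bopE ?rdot_adj ?adjointK// -rdot_adjr.
  apply: le_trans (lerXn2r _ _ _ wu) _; rewrite ?nnegrE ?sumr_ge0//.
  have k2 : (2 * k = (2 * k - 1).+1)%N by rewrite subn1 prednK// muln_gt0.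
  rewrite [X in _ ^+ X <= _]k2.
  apply: le_trans (exprn_sum_le _ n1 u0) _; rewrite -k2 -/N.
  apply: (@le_trans _ _ (N / m%:R * \sum_(1 <= j < m.+1) \sum_(i < n) (E i j - r0 ^+ k * D x i j))).
    rewrite -mulrA ler_wpM2l// mulrC ler_pdivlMr// mulrC.
    have -> : m%:R * (\sum_(i < n) u i ^+ (2 * k)) = \sum_(1 <= j < m.+1) \sum_(i < n) u i ^+ (2 * k).
      by rewrite sumr_const_nat subn1 mulr_natl.
    rewrite !big_nat; apply: ler_sum => j /andP[_ jm]; apply: ler_sum => i _.
    exact: uED.
  have -> : \sum_(1 <= j < m.+1) \sum_(i < n) (E i j - r0 ^+ k * D x i j) =
    \sum_(1 <= j < m.+1) \sum_(i < n) E i j - r0 ^+ k * \sum_(1 <= j < m.+1) \sum_(i < n) D x i j.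
    rewrite mulr_sumr -sumrB; apply: eq_bigr => j _.
    by rewrite mulr_sumr -sumrB.
  rewrite mulrBr lerD2l lerN2 mulrCA ler_wpM2l//; exact: infP.
have [[x x1]|empty] := pselect (exists x : H, vnorm x = 1); last first.
  (* the zero space: the supremum and the infimum are both 0 *)
  have E0 : [set x : H | `|x| = 1] = set0.
    apply/seteqP; split=> // x /= x1; apply: empty; exists x.
    by rewrite /vnorm x1.
  rewrite /RHS /numradius E0 !image_set0 sup0 inf0 mulr0 subr0.
  rewrite expr0n muln_eq0/= eqn0Ngt k1/= mulr_ge0//.
  by do 2 (apply: sumr_ge0 => ? _); exact: powR_ge0.
have RHS0 : 0 <= RHS by apply: le_trans (pointwise x x1); rewrite exprn_ge0.
have k20 : (0 < 2 * k)%N by rewrite muln_gt0.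
pose M := RHS `^ (2 * k)%:R^-1.
have ME : M ^+ (2 * k) = RHS.
  by rewrite -powR_mulrn ?powR_ge0// -powRrM mulVf ?powRr1// pnatr_eq0 -lt0n.
have wM y : vnorm y = 1 -> w y <= M.
  move=> y1; rewrite -(@ler_pXn2r _ (2 * k)) ?nnegrE ?powR_ge0// ME.
  exact: pointwise.
have nx y : [set x : H | `|x| = 1] y -> vnorm y = 1 by rewrite /vnorm /= => ->.
rewrite -ME; apply: lerXn2r; rewrite ?nnegrE ?powR_ge0//.
- apply: le_trans (w0 x) _; apply: ub_le_sup.
    by exists M => _ [y /nx/wM + <-].
  by exists x => //=; rewrite vnormE x1.
- apply: ge_sup; first by exists (w x), x => //=; rewrite vnormE x1.
  by move=> _ [y /nx/wM + <-].
Qed.
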